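(* Let $n\geq 3$ be an integer and let $\varepsilon>0$. There is a constant $c=c(n,\varepsilon)$, depending only on $n$ and $\varepsilon$, such that for every quadratic form $F(\mathbf{x})\in\mathbb{Z}[x_1,\ldots,x_n]$ of rank at least $3$ and every real $B\geq 1$, $$N(F;B)\leq c\,B^{n-2+\varepsilon}.$$
   Context: $Z_n$ denotes the set of all $\mathbf{x}=(x_1,\ldots,x_n)\in\mathbb{Z}^n$, not all $x_i$ zero, with $\gcd(x_1,\ldots,x_n)=1$ and such that $x_i>0$ for the smallest index $i$ with $x_i\neq 0$. For a form $F$ in $n$ variables and $B\geq 1$, $$N(F;B)=\#\{\mathbf{x}\in Z_n:\ F(\mathbf{x})=0,\ \max_{1\leq i\leq n}|x_i|\leq B\}.$$ *)

(* Defs.v *)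
From HB Require Import structures.
From mathcomp Require Import all_boot all_order all_algebra.
From mathcomp Require Import finmap mpoly zify.
From mathcomp Require Import boolp classical_sets functions cardinality reals.

Set Implicit Arguments.
Unset Strict Implicit.
Unset Printing Implicit Defensive.

Import Order.TTheory GRing.Theory Num.Theory.
Local Open Scope ring_scope.
Local Open Scope classical_set_scope.

(* The symmetric rational matrix A with F(x) = x A x^T for a quadratic form F:
   the off-diagonal entries are half of the mixed coefficients of F. *)
Definition gram_mx (n : nat) (F : {mpoly int[n]}) : 'M[rat]_n :=
  \matrix_(i, j)
    if i == j then (F@_(U_(i) + U_(i)))%:~R
    else (F@_(U_(i) + U_(j)))%:~R / 2.

Definition qf_rank (n : nat) (F : {mpoly int[n]}) : nat := \rank (gram_mx F).

Definition height (n : nat) (x : 'rV[int]_n) : nat :=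
  \max_(i < n) `|x ord0 i|%N.

Definition Zprim (n : nat) : set 'rV[int]_n :=
  [set x | [/\ exists i, x ord0 i != 0,
               \big[gcdn/0%N]_(i < n) `|x ord0 i|%N = 1%N
             & forall i : 'I_n, x ord0 i != 0 ->
                 (forall j : 'I_n, (j < i)%N -> x ord0 j = 0) ->
                 0 < x ord0 i]].

Definition zeros_upto (R : realType) (n : nat) (F : {mpoly int[n]}) (B : R) :
    set 'rV[int]_n :=
  [set x | [/\ Zprim x, F.@[fun i => x ord0 i] = 0 & (height x)%:R <= B]].

(* fset_set is a junk value on infinite sets; this shows that the cardinality
   taken in Ncount is a genuine one. *)
Lemma finite_zeros_upto (R : realType) (n : nat) (F : {mpoly int[n]}) (B : R) :
  finite_set (zeros_upto F B).
Proof.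
set k := Num.truncn B.
pose f (g : {ffun 'I_n -> 'I_(k + k).+1}) : 'rV[int]_n :=
  \row_i ((g i)%:Z - k%:Z).
apply: (@sub_finite_set _ _ (f @` setT)); last exact/finite_image/finite_finset.
move=> x [_ _ hx].
have xk i : (`|x ord0 i| <= k)%N.
  rewrite truncn_ge_nat; last by apply: le_trans hx; rewrite ler0n.
  by apply: le_trans hx; rewrite ler_nat /height (leq_bigmax i).
exists [ffun i => inord `|(x ord0 i + k%:Z)%R|%N] => //.
apply/rowP => i; rewrite mxE ffunE.
rewrite inordK; move: (xk i); rewrite (ord1 0); lia.
Qed.

Definition Ncount (R : realType) (n : nat) (F : {mpoly int[n]}) (B : R) : nat :=
  #|` fset_set (zeros_upto F B)|%fset.

(* Main.v *)
(* All integer zeros of height at most B are counted, primitive or not.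

   Completing squares twice writes the equation F(x) = 0, in coordinates where
   two leading pivots do not vanish, as X^2 - D Y^2 = N with D != 0, where N is
   a quadratic form in the remaining n - 2 coordinates w, and where (X, Y)
   determines x once w is fixed. A third nonzero pivot, which exists since the
   rank is at least 3, shows that N(w) = 0 for few w. There are O(B^(n-2))
   choices for w, and if N(w) != 0 the Pell-type equation has O(T^eps) solutions
   of size at most T, uniformly in D and N of size at most T: up to a divisor
   bound the solutions fall into classes modulo units of norm 1, and those grow
   geometrically.

   For uniformity in F, T must be polynomial in B. The forms vanishing at all the
   zeros of F of height at most B make up a space spanned by integral forms whose
   coefficients are polynomial in B. The product of the pivots is a polynomial
   that is nonzero at F, so it is nonzero at some combination of these spanning
   forms with small coefficients, and this form can replace F. *)

Require Import Defs.
From mathcomp Require Import all_boot all_order all_algebra.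
From mathcomp Require Import mpoly reals exp.
From mathcomp Require Import perm finmap classical_sets cardinality zify ring lra.

Set Implicit Arguments.
Unset Strict Implicit.
Unset Printing Implicit Defensive.

Import Order.TTheory GRing.Theory Num.Theory.

(** * The divisor bound *)

Lemma size_le_fibres (T U : eqType) (f : T -> U) (t : seq U) (s : seq T) K :
    (forall x, x \in s -> f x \in t) ->
    (forall u, u \in t -> count (fun x => f x == u) s <= K) ->
  size s <= size t * K.
Proof.
elim: t s => [|u t IHt] s fst leK.
  by case: s fst {leK} => // x s /(_ x (mem_head _ _)).
rewrite -(count_predC (fun x => f x == u)) mulSn leq_add ?leK ?mem_head //.
rewrite -size_filter; apply: IHt => [x|v tv].
  rewrite mem_filter => /andP[/= fxu /fst].
  by rewrite inE (negPf fxu).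
rewrite count_filter (leq_trans _ (leK v _)) ?inE ?tv ?orbT //.
by apply: sub_count => x /= /andP[].
Qed.

(** A divisor d is recovered from the exponent i in gcd(d, p^a) = p^i and the quotient d / p^i,
    which divides m because it is coprime to p^a / p^i. *)
Lemma size_divisors_pfactor p a m : prime p -> 0 < m ->
  size (divisors (p ^ a * m)) <= a.+1 * size (divisors m).
Proof.
move=> p_pr m_gt0.
have pam_gt0 : 0 < p ^ a * m by rewrite muln_gt0 expn_gt0 prime_gt0.
have -> : a.+1 * size (divisors m) =
    size [seq p ^ i * d | i <- iota 0 a.+1, d <- divisors m].
  by rewrite size_allpairs size_iota.
apply: uniq_leq_size (divisors_uniq _) _ => d.
rewrite -dvdn_divisors // => d_dv.
have [i le_ia gE] := dvdn_pfactor (gcdn d (p ^ a)) a p_pr (dvdn_gcdr _ _).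
have d_gt0 := dvdn_gt0 pam_gt0 d_dv.
have g_gt0 : 0 < gcdn d (p ^ a) by rewrite gcdn_gt0 d_gt0.
apply/allpairsP; exists (i, d %/ gcdn d (p ^ a)).
rewrite [(_, _).1]/= [(_, _).2]/= -gE mem_iota add0n ltnS le_ia.
rewrite [gcdn _ _ * _]mulnC divnK ?dvdn_gcdl //; split => //.
rewrite -dvdn_divisors //.
have cop : coprime (d %/ gcdn d (p ^ a)) (p ^ a %/ gcdn d (p ^ a)).
  rewrite /coprime -(eqn_pmul2r g_gt0) mul1n muln_gcdl.
  by rewrite !divnK ?dvdn_gcdl ?dvdn_gcdr.
rewrite -(Gauss_dvdr _ cop) -(dvdn_pmul2r g_gt0) divnK ?dvdn_gcdl //.
by rewrite mulnAC divnK ?dvdn_gcdr.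
Qed.

(** For k > 0 and q = [a %/ k], a + 1 <= k (q + 1) <= k 2^q; take k-th powers. *)
Lemma expn_succ_le k a : a.+1 ^ k <= k ^ k * 2 ^ a.
Proof.
case: k => [|k]; first by rewrite mul1n expn_gt0.
have le1 : a.+1 <= k.+1 * 2 ^ (a %/ k.+1).
  apply: (@leq_trans (k.+1 * (a %/ k.+1).+1)); last first.
    by rewrite leq_mul2l ltn_expl ?orbT.
  by rewrite mulnC ltn_ceil.
apply: (@leq_trans ((k.+1 * 2 ^ (a %/ k.+1)) ^ k.+1)); first by rewrite leq_exp2r.
rewrite expnMn leq_mul2l -expnM leq_exp2l ?leq_trunc_div ?orbT //.
Qed.

(** If p^a is the exact power of p in n, then (a + 1)^k is at most 2^(a k) <= p^a when p >= 2^k, and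
    at most k^k p^a otherwise. Only the finitely many primes below 2^k cost a constant. *)
Lemma divisor_bound k : exists2 C, 0 < C &
  forall n, 0 < n -> size (divisors n) ^ k <= C * n.
Proof.
(* Induction on b strips the small primes one at a time, at the cost of one factor k^k for each
   candidate. When b = 0, every prime factor is at least 2^k and a strong induction on n remains. *)
suff main b n : 0 < n ->
    (forall p, prime p -> p %| n -> (p < b) || (2 ^ k <= p)) ->
    size (divisors n) ^ k <= (k ^ k) ^ b * n.
  exists ((k ^ k) ^ (2 ^ k)) => [|n n_gt0].
    by rewrite !expn_gt0; case: k {main}.
  by apply: main => // p _ _; rewrite orbC leqNgt orNb.
elim: b n => [n|b IHb n] n_gt0.
  have [m] := ubnP n; elim: m n n_gt0 => // m IHm n n_gt0 lenm big.
  have [n1|n_gt1] := leqP n 1.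
    by have -> : n = 1 by [lia]; rewrite /= muln1 exp1n.
  have p_pr := pdiv_prime n_gt1; set p := pdiv n in p_pr.
  have [q cop nE] := pfactor_coprime p_pr n_gt0.
  have q_gt0 : 0 < q by move: n_gt0; rewrite nE; case: (q).
  have a_gt0 : 0 < logn p n by rewrite logn_gt0 mem_primes p_pr n_gt0 pdiv_dvd.
  have p_ge : 2 ^ k <= p by have := big _ p_pr (pdiv_dvd n).
  have le1 := size_divisors_pfactor (logn p n) p_pr q_gt0.
  rewrite mulnC -nE in le1.
  have le2 : size (divisors q) ^ k <= (k ^ k) ^ 0 * q.
    apply: IHm => // [|r r_pr rq]; last by apply: big => //; rewrite nE dvdn_mulr.
    rewrite -ltnS (leq_trans _ lenm) // ltnS nE ltn_Pmulr //.
    by rewrite -{1}(expn0 p) ltn_exp2l // prime_gt1.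
  apply: (@leq_trans ((logn p n).+1 ^ k * size (divisors q) ^ k)).
    by rewrite -expnMn; case: (k) => // ?; rewrite leq_exp2r.
  rewrite [in leqRHS]nE mulnA mulnC leq_mul //.
  apply: (@leq_trans ((2 ^ logn p n) ^ k)).
    by case: (k) => // ?; rewrite leq_exp2r // ltn_expl.
  by rewrite -expnM mulnC expnM; case: (logn p n) a_gt0 => // ? _; rewrite leq_exp2r.
have [b_pr|b_npr] := boolP (prime b); last first.
  move=> big; apply: leq_trans (IHb n n_gt0 _) _.
    move=> p p_pr pn; have /orP[|->] := big p p_pr pn; last by rewrite orbT.
    rewrite ltnS leq_eqVlt => /orP[/eqP pb|->//].
    by rewrite pb (negPf b_npr) in p_pr.
  by rewrite leq_mul2r expnS leq_pmull ?orbT // expn_gt0; case: (k).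
move=> big; have [q cop nE] := pfactor_coprime b_pr n_gt0.
have q_gt0 : 0 < q by move: n_gt0; rewrite nE; case: (q).
have le1 := size_divisors_pfactor (logn b n) b_pr q_gt0.
rewrite mulnC -nE in le1.
have le2 : size (divisors q) ^ k <= (k ^ k) ^ b * q.
  apply: IHb => // r r_pr rq.
  have rn : r %| n by rewrite nE dvdn_mulr.
  have /orP[|->] := big r r_pr rn; last by rewrite orbT.
  rewrite ltnS leq_eqVlt => /orP[/eqP rb|->//].
  by move: cop; rewrite prime_coprime // -rb rq.
apply: (@leq_trans ((logn b n).+1 ^ k * size (divisors q) ^ k)).
  by rewrite -expnMn; case: (k) => // ?; rewrite leq_exp2r.
rewrite expnS [in leqRHS]nE [q * _]mulnC mulnACA leq_mul //.
apply: leq_trans (expn_succ_le k _) _; rewrite leq_mul2l.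
by case: (logn b n) => [|?]; rewrite ?orbT // leq_exp2r ?prime_gt1 ?orbT.
Qed.

(** * Equations of Pell type *)

(** Numbers that at least double have distinct binary logarithms. *)
Lemma size_lacunary (s : seq nat) M : uniq s ->
    (forall v, v \in s -> 0 < v <= M) ->
    {in s &, forall v w, v < w -> 2 * v <= w} ->
  size s <= (trunc_log 2 M).+1.
Proof.
move=> s_uniq s_le s_lac.
have log_inj : {in s &, injective (trunc_log 2)}.
  move=> v w sv sw eq_log.
  wlog lt_vw : v w sv sw eq_log / v < w => [wlog_lt|].
    by case: (ltngtP v w) => // ?; [|symmetry]; apply: wlog_lt.
  have /andP[v_gt0 _] := s_le v sv.
  have := leq_trunc_log 2 (s_lac v w sv sw lt_vw).
  by rewrite trunc_logMp // eq_log ltnn.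
rewrite -(size_map (trunc_log 2)) -(size_iota 0 (trunc_log 2 M).+1).
apply: uniq_leq_size => [|_ /mapP[v sv ->]]; first by rewrite map_inj_in_uniq.
have /andP[_ leM] := s_le v sv.
by rewrite mem_iota add0n /= ltnS leq_trunc_log.
Qed.

Local Open Scope ring_scope.

(* With e_i = u_i + v_i sqrt D, the quotient e2 / e1 is again a solution
   x + y sqrt D with x, y >= 1, so that v2 = u1 y + v1 x >= u1 + v1 >= 2 v1. *)
Lemma pell_double (D u1 v1 u2 v2 : int) : 0 < D -> 0 <= u1 -> 0 < v1 ->
    0 <= u2 -> v1 < v2 ->
    u1 ^+ 2 - D * v1 ^+ 2 = 1 -> u2 ^+ 2 - D * v2 ^+ 2 = 1 ->
  2 * v1 <= v2.
Proof.
move=> D0 u10 v10 u20 lt12 e1 e2.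
have v20 : 0 < v2 by lia.
have le1 : v1 <= u1.
  rewrite -(@ler_pXn2r _ 2) ?nnegrE // ?ltW //; nia.
set y := u1 * v2 - u2 * v1; set x := u1 * u2 - D * v1 * v2.
have y_gt0 : 0 < y.
  rewrite subr_gt0 -(@ltr_pXn2r _ 2) ?nnegrE ?mulr_ge0 // ?ltW //.
  rewrite !exprMn.
  have -> : u1 ^+ 2 = 1 + D * v1 ^+ 2 by lia.
  have -> : u2 ^+ 2 = 1 + D * v2 ^+ 2 by lia.
  have : v1 ^+ 2 < v2 ^+ 2 by rewrite ltr_pXn2r ?nnegrE ?ltW.
  set a := v1 ^+ 2; set b := v2 ^+ 2; nia.
have x_gt0 : 0 < x.
  rewrite subr_gt0 -(@ltr_pXn2r _ 2) ?nnegrE ?mulr_ge0 // ?ltW //.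
  rewrite !exprMn.
  have -> : u1 ^+ 2 = 1 + D * v1 ^+ 2 by lia.
  have -> : u2 ^+ 2 = 1 + D * v2 ^+ 2 by lia.
  have : 0 < v1 ^+ 2 by rewrite exprn_gt0.
  have : 0 < v2 ^+ 2 by rewrite exprn_gt0.
  set a := v1 ^+ 2; set b := v2 ^+ 2 => a0 b0.
  have -> : (1 + D * a) * (1 + D * b) = 1 + D * a + D * b + D ^+ 2 * a * b by ring.
  have : 0 < D * a by rewrite mulr_gt0.
  have : 0 < D * b by rewrite mulr_gt0.
  lia.
have -> : v2 = u1 * y + v1 * x.
  have -> : u1 * y + v1 * x = v2 * (u1 ^+ 2 - D * v1 ^+ 2) by rewrite /x /y; ring.
  by rewrite e1 mulr1.
nia.
Qed.

(** The positive values of |v| at least double by [pell_double], so there are logarithmically many;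
    each |v|, including 0, leaves at most four choices of signs. *)
Lemma size_pell_units (D : int) (M : nat) (s : seq (int * int)) :
    D != 0 -> uniq s ->
    (forall u v, (u, v) \in s -> u ^+ 2 - D * v ^+ 2 = 1 /\ (`|v| <= M)%N) ->
  (size s <= 4 * (trunc_log 2 M + 2))%N.
Proof.
move=> D0 s_uniq sP.
pose t := [seq v <- undup [seq `|p.2|%N | p <- s] | (0 < v)%N].
have tP v : v \in t -> (0 < v <= M)%N /\
    exists2 u : int, 0 <= u & u ^+ 2 - D * v%:Z ^+ 2 = 1.
  rewrite mem_filter mem_undup => /andP[v0 /mapP[[u w] /sP[e leM] /= vE]].
  split; first by rewrite v0 vE.
  by exists `|u| => //; rewrite vE abszE !real_normK ?num_real.
have size_t : (size t <= (trunc_log 2 M).+1)%N.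
  apply: size_lacunary => [|v /tP[]//|v w /tP[/andP[v0 _] [u1 u10 e1]]].
    by rewrite filter_uniq ?undup_uniq.
  move=> /tP[/andP[w0 _] [u2 u20 e2]] lt_vw.
  (* For negative D, two distinct positive values would give w >= 2 and a norm of at least 4. *)
  have [D_lt0|D_gt0] : D < 0 \/ 0 < D by lia.
    have : 0 <= u2 ^+ 2 by rewrite exprn_ge0.
    have : (2 * 2 <= w ^ 2)%N by rewrite (@leq_exp2r 2 _ 2) //; lia.
    have := e2; rewrite -[w%:Z ^+ 2]/((w ^ 2)%N%:Z) => {}e2; nia.
  have : 2 * v%:Z <= w%:Z; last by lia.
  by apply: (pell_double D_gt0 u10 _ u20 _ e1 e2); lia.
apply: (@leq_trans (size (0%N :: t) * 4)); last by rewrite /=; lia.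
apply: (@size_le_fibres _ _ (fun p => `|p.2|%N)) => [[u v] sp|v _].
  rewrite inE mem_filter mem_undup; case: eqP => //= /eqP.
  by rewrite -lt0n => ->; apply: (map_f (fun p => `|p.2|%N) sp).
rewrite -size_filter.
case sE: [seq x <- s | _] => [//|[u0 v0] s'].
have : (u0, v0) \in [seq x <- s | `|x.2|%N == v] by rewrite sE mem_head.
rewrite -sE mem_filter => /andP[/eqP v0E /sP[e0 _]].
apply: (@uniq_leq_size _ _ [:: (u0, v0); (u0, - v0); (- u0, v0); (- u0, - v0)]).
  by rewrite filter_uniq.
move=> [u1 v1]; rewrite mem_filter => /andP[/eqP v1E /sP[e1 _]].
have v1E' : v1 = v0 \/ v1 = - v0 by move: v0E v1E => /=; lia.
have /eqP : u1 ^+ 2 = u0 ^+ 2.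
  have : v1 ^+ 2 = v0 ^+ 2 by case: v1E' => ->; rewrite ?sqrrN.
  by move=> ev; rewrite ev in e1; lia.
rewrite eqf_sqr => /orP[] /eqP ->; have [->|->] := v1E'.
all: by rewrite !inE eqxx ?orbT.
Qed.

Lemma coprimez_norm (D N X Y : int) :
  coprimez X Y -> X ^+ 2 - D * Y ^+ 2 = N -> coprimez Y N.
Proof.
move=> cop <-; rewrite /coprimez.
have -> : X ^+ 2 - D * Y ^+ 2 = (- D * Y) * Y + X ^+ 2 by ring.
by rewrite gcdzMDl -/(coprimez _ _) coprimezXr // coprimez_sym.
Qed.

(** Let g be the common gcd, M = g h and t = X1 / Y1 modulo M. For i = 2, 3, Xi = t Yi modulo g and
    Xi = - t Yi modulo h. So g and h both divide X2 Y3 - X3 Y2, and e = gcd(g, h) makes up for what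
    their least common multiple lacks against M. *)
Lemma mod_cross_gcd (M X1 Y1 X2 Y2 X3 Y3 : int) :
    M != 0 -> coprimez Y1 M ->
    (M %| (X1 * Y2 - X2 * Y1) * (X1 * Y2 + X2 * Y1))%Z ->
    (M %| (X1 * Y3 - X3 * Y1) * (X1 * Y3 + X3 * Y1))%Z ->
    gcdz (X1 * Y2 - X2 * Y1) M = gcdz (X1 * Y3 - X3 * Y1) M ->
  exists e : int, [/\ (e ^+ 2 %| M)%Z,
    (e %| 2 * X1 * Y2)%Z & (M %| e * (X2 * Y3 - X3 * Y2))%Z].
Proof.
move=> M0 cop1 dv2 dv3 eq_g; move gE0 : (gcdz _ M) eq_g => g eq_g.
have g_ge0 : 0 <= g by rewrite -gE0.
have g0 : g != 0 by rewrite -gE0 gcdz_eq0 negb_and M0 orbT.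
have [h ME] : exists h, M = g * h.
  have /dvdzP[h ->] : (g %| M)%Z by rewrite -gE0 dvdz_gcdr.
  by exists h; rewrite mulrC.
have key X Y : (M %| (X1 * Y - X * Y1) * (X1 * Y + X * Y1))%Z ->
    gcdz (X1 * Y - X * Y1) M = g ->
    (g %| X1 * Y - X * Y1)%Z /\ (h %| X1 * Y + X * Y1)%Z.
  move=> dv gE; have gZ : (g %| X1 * Y - X * Y1)%Z by rewrite -gE dvdz_gcdl.
  split=> //; move/dvdzP: (gZ) => [z ZE].
  have cop : coprimez h z.
    move: gE; rewrite ZE ME [z * g]mulrC -mulz_gcdr gez0_abs //.
    by rewrite -{2}[g]mulr1 coprimez_sym /coprimez => /(mulfI g0) ->.
  by move: dv; rewrite ZE ME [z * g]mulrC -mulrA dvdz_mul2l // Gauss_dvdzr.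
have [gZ2 hW2] := key _ _ dv2 gE0.
have [gZ3 hW3] := key _ _ dv3 (esym eq_g).
have cop_g : coprimez g Y1.
  by rewrite coprimez_sym; move: cop1; rewrite ME coprimezMr => /andP[].
have cop_h : coprimez h Y1.
  by rewrite coprimez_sym; move: cop1; rewrite ME coprimezMr => /andP[].
have gV : (g %| X2 * Y3 - X3 * Y2)%Z.
  rewrite -(Gauss_dvdzr _ cop_g).
  have -> : Y1 * (X2 * Y3 - X3 * Y2) =
    Y2 * (X1 * Y3 - X3 * Y1) - Y3 * (X1 * Y2 - X2 * Y1) by ring.
  by rewrite rpredB // dvdz_mull.
have hV : (h %| X2 * Y3 - X3 * Y2)%Z.
  rewrite -(Gauss_dvdzr _ cop_h).
  have -> : Y1 * (X2 * Y3 - X3 * Y2) =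
    Y3 * (X1 * Y2 + X2 * Y1) - Y2 * (X1 * Y3 + X3 * Y1) by ring.
  by rewrite rpredB // dvdz_mull.
exists (gcdz g h); split.
- by rewrite ME expr2 dvdz_mul ?dvdz_gcdl ?dvdz_gcdr.
- have -> : 2 * X1 * Y2 = (X1 * Y2 - X2 * Y1) + (X1 * Y2 + X2 * Y1) by ring.
  by rewrite rpredD // ?(dvdz_trans (dvdz_gcdl _ _) gZ2)
    ?(dvdz_trans (dvdz_gcdr _ _) hW2).
- have [u [v <-]] := Bezoutz g h; rewrite ME mulrDl rpredD //.
    by rewrite -mulrA dvdz_mull // dvdz_mul.
  by rewrite -mulrA dvdz_mull // mulrC dvdz_mul.
Qed.

Definition squarefree (D : int) := forall e : int, (e ^+ 2 %| D)%Z -> `|e|%N = 1%N.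

Lemma squarefree_dvd4 (D e : int) :
  squarefree D -> (e ^+ 2 %| 4 * D)%Z -> (e %| 2)%Z.
Proof.
move=> sqf dv; have [/dvdzP[f eE]|odd_e] := boolP (2 %| e)%Z.
  move: dv; rewrite eE -(mulrC 2) exprMn dvdz_mul2l // => /sqf f1.
  by have [->|->] : f = 1 \/ f = -1 by lia.
have cop : coprimez (e ^+ 2) 4.
  rewrite coprimezXl // (_ : 4 = 2 ^+ 2) // coprimezXr // coprimez_sym.
  by rewrite coprimezE prime_coprime // -dvdzE.
by move: dv; rewrite Gauss_dvdzr // => /sqf e1; rewrite dvdzE e1.
Qed.

(* Equal gcds mean that (X2, Y2) and (X3, Y3) generate the same ideal, of norm N. *)
Lemma cross_dvd (D N q X1 Y1 X2 Y2 X3 Y3 : int) :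
    squarefree D -> N != 0 -> q = gcdz N 2 ->
    coprimez X1 Y1 -> coprimez X2 Y2 ->
    X1 ^+ 2 - D * Y1 ^+ 2 = N -> X2 ^+ 2 - D * Y2 ^+ 2 = N ->
    X3 ^+ 2 - D * Y3 ^+ 2 = N -> coprimez X3 Y3 ->
    gcdz (X1 * Y2 - X2 * Y1) (q * N) = gcdz (X1 * Y3 - X3 * Y1) (q * N) ->
  (N %| X2 * Y3 - X3 * Y2)%Z.
Proof.
move=> sqf N0 qE cop1 cop2 e1 e2 e3 cop3 eq_g.
have q0 : q != 0 by rewrite qE gcdz_eq0 negb_and N0.
have copY Y X : coprimez X Y -> X ^+ 2 - D * Y ^+ 2 = N ->
    coprimez Y N * coprimez Y q.
  move=> cop e; have c := coprimez_norm cop e; split => //.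
  by rewrite qE (@coprimez_dvdr _ `|N|) ?dvdn_gcdl.
(* The extra factor q comes from here: if q = 2 then Y is odd, and the product of the two cross
   terms is (Y^2 - Y1^2) N. *)
have oddsq Y : coprimez Y q -> (q %| Y ^+ 2 - 1)%Z.
  have : q = 1 \/ q = 2.
    have : (q %| 2)%Z by rewrite qE dvdz_gcdr.
    have : 0 <= q by rewrite qE.
    case: (q) q0 => // k k0 _; rewrite dvdzE /= => /dvdn_leq -/(_ isT).
    by case: k k0 => [|[|[|]]] // _ _; [left|right].
  case=> -> //; rewrite coprimez_sym coprimezE prime_coprime //= => odd_Y.
  have -> : Y ^+ 2 - 1 = (Y - 1) * (Y + 1) by ring.
  by rewrite dvdz_mulr //; lia.
have dv X Y : coprimez X Y -> X ^+ 2 - D * Y ^+ 2 = N ->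
    (q * N %| (X1 * Y - X * Y1) * (X1 * Y + X * Y1))%Z.
  move=> cop e; have -> : (X1 * Y - X * Y1) * (X1 * Y + X * Y1) =
      ((Y ^+ 2 - 1) - (Y1 ^+ 2 - 1)) * N.
    transitivity (X1 ^+ 2 * Y ^+ 2 - X ^+ 2 * Y1 ^+ 2); first by ring.
    have -> : X1 ^+ 2 = N + D * Y1 ^+ 2 by rewrite -e1; ring.
    have -> : X ^+ 2 = N + D * Y ^+ 2 by rewrite -e; ring.
    by ring.
  by rewrite dvdz_mul // rpredB // oddsq // (copY _ _ _ (e1), copY _ _ _ e).
have M0 : q * N != 0 by rewrite mulf_neq0.
have copM : coprimez Y1 (q * N) by rewrite coprimezMr !(copY _ _ cop1 e1).
have [e [e_sq e_dv dvV]] :=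
  mod_cross_gcd M0 copM (dv _ _ cop2 e2) (dv _ _ cop3 e3) eq_g.
have e_M : (e %| q * N)%Z by apply: dvdz_trans e_sq; rewrite expr2 dvdz_mulr.
have copeY X Y : coprimez X Y -> X ^+ 2 - D * Y ^+ 2 = N -> coprimez e Y.
  move=> cop h; rewrite coprimez_sym coprimezE (@coprime_dvdr _ `|(q * N)%R|) //.
  by rewrite -coprimezE coprimezMr !(copY _ _ cop h).
have e2X : (e %| 2 * X1)%Z.
  by rewrite -(Gauss_dvdzl _ (copeY _ _ cop2 e2)).
(* Here e^2 divides q N, hence 4 N, and e divides 2 X1, so the equation for (X1, Y1) gives e^2 | 4 D
   Y1^2. Squarefreeness then leaves only e | 2. *)
have e_4D : (e ^+ 2 %| 4 * D)%Z.
  have cop : coprimez (e ^+ 2) (Y1 ^+ 2).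
    by rewrite coprimezXl // coprimezXr // (copeY _ _ cop1 e1).
  rewrite -(Gauss_dvdzr _ cop).
  have -> : Y1 ^+ 2 * (4 * D) = (2 * X1) ^+ 2 - 4 * N by rewrite -e1; ring.
  rewrite rpredB ?dvdz_exp2r //; apply: dvdz_trans e_sq _.
  have -> : 4 * N = 2 * (2 * N) by ring.
  have : (q %| 2)%Z by rewrite qE dvdz_gcdr.
  by move=> q2; rewrite dvdz_mull // dvdz_mul.
have e_2 := squarefree_dvd4 sqf e_4D.
(* This lets e cancel against q in q N | e (X2 Y3 - X3 Y2). For odd N, e divides both N and 2. *)
have e_q : (e %| q)%Z.
  have [N2|N2] := boolP (2 %| N)%Z.
    by rewrite qE dvdz_gcd (dvdz_trans e_2 N2).
  rewrite qE; have : coprimez N 2.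
    by rewrite coprimez_sym coprimezE prime_coprime // -dvdzE.
  move=> copN; have q1 : q = 1 by rewrite qE; apply/eqP.
  rewrite -qE q1; move: e_M; rewrite q1 mul1r => eN.
  rewrite -(eqP copN) dvdz_gcd eN e_2 //.
have /dvdzP[f qf] := e_q.
have e0 : e != 0 by apply: contraNneq q0 => e0; rewrite qf e0 mulr0.
by rewrite -(dvdz_mul2l e0); apply: dvdz_trans dvV; rewrite qf -mulrA dvdz_mull.
Qed.

(** The formal quotient (X + Y sqrt D) / (X2 + Y2 sqrt D) = u + v sqrt D has norm 1. The
    divisibility hypothesis makes v integral, and then u is integral because (u N)^2 = N^2 + D (v
    N)^2. Distinct solutions give distinct units. *)
Lemma size_pell_class (D N X2 Y2 : int) (T : nat) (s : seq (int * int)) :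
    D != 0 -> N != 0 -> uniq s -> X2 ^+ 2 - D * Y2 ^+ 2 = N ->
    (`|X2| <= T)%N -> (`|Y2| <= T)%N ->
    (forall X Y, (X, Y) \in s -> [/\ X ^+ 2 - D * Y ^+ 2 = N,
      (`|X| <= T)%N, (`|Y| <= T)%N & (N %| X2 * Y - X * Y2)%Z]) ->
  (size s <= 4 * (trunc_log 2 (2 * T ^ 2) + 2))%N.
Proof.
move=> D0 N0 s_uniq e2 leX2 leY2 sP.
pose u (p : int * int) := ((X2 * p.1 - D * Y2 * p.2) %/ N)%Z.
pose v (p : int * int) := ((X2 * p.2 - p.1 * Y2) %/ N)%Z.
have uvP X Y : (X, Y) \in s -> X2 * X - D * Y2 * Y = u (X, Y) * N /\
    X2 * Y - X * Y2 = v (X, Y) * N.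
  move=> /sP[e leX leY dv]; rewrite !divzK //.
  rewrite -(@dvdz_pexp2r _ _ 2) //.
  have -> : (X2 * X - D * Y2 * Y) ^+ 2 =
    N ^+ 2 + D * (X2 * Y - X * Y2) ^+ 2.
    have <- : (X2 ^+ 2 - D * Y2 ^+ 2) * (X ^+ 2 - D * Y ^+ 2) = N ^+ 2.
      by rewrite e2 e -expr2.
    by ring.
  by rewrite rpredD // dvdz_mull // dvdz_exp2r.
rewrite -(size_map (fun p => (u p, v p))); apply: size_pell_units D0 _ _.
  rewrite map_inj_in_uniq // => -[X Y] [X' Y'] sX sX' [eu ev].
  have [eU eV] := uvP _ _ sX; have [eU' eV'] := uvP _ _ sX'.
  rewrite -eu in eU'; rewrite -ev in eV'.
  congr (_, _); apply: (mulfI N0).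
    transitivity (X2 * (u (X, Y) * N) + D * Y2 * (v (X, Y) * N)).
      by rewrite -eU -eV -e2; ring.
    by rewrite -eU' -eV' -e2; ring.
  transitivity (Y2 * (u (X, Y) * N) + X2 * (v (X, Y) * N)).
    by rewrite -eU -eV -e2; ring.
  by rewrite -eU' -eV' -e2; ring.
move=> u' v' /mapP[[X Y] sX [-> ->]].
have [eU eV] := uvP _ _ sX; have [e leX leY dv] := sP _ _ sX.
set a := u _ in eU *; set b := v _ in eV *; split.
  have N20 : N ^+ 2 != 0 by rewrite expf_neq0.
  apply: (mulIf N20); rewrite mul1r.
  transitivity ((a * N) ^+ 2 - D * (b * N) ^+ 2); first by ring.
  rewrite -eU -eV.
  have <- : (X2 ^+ 2 - D * Y2 ^+ 2) * (X ^+ 2 - D * Y ^+ 2) = N ^+ 2.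
    by rewrite e2 e -expr2.
  by ring.
apply: (@leq_trans `|(b * N)%R|%N); first by rewrite abszM leq_pmulr // absz_gt0.
rewrite -eV; apply: (@leq_trans (`|X2| * `|Y| + `|X| * `|Y2|)%N).
  by rewrite -!abszM; move: (X2 * Y) (X * Y2) => x y; clear; lia.
by rewrite mul2n -addnn -mulnn leq_add // leq_mul.
Qed.

(* For odd N a key modulo N would do. For even N, all Y are odd, so that 2 N
   divides the product of X1 Y - X Y1 and X1 Y + X Y1; keeping this factor 2 in
   the key makes up for the common factor 2 of these two numbers. *)
Lemma size_pell_prim (D N : int) (T : nat) (s : seq (int * int)) :
    D != 0 -> N != 0 -> squarefree D -> uniq s ->
    (forall X Y, (X, Y) \in s -> [/\ X ^+ 2 - D * Y ^+ 2 = N,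
      (`|X| <= T)%N, (`|Y| <= T)%N & coprimez X Y]) ->
  (size s <= size (divisors (gcdn `|N| 2 * `|N|)) *
             (4 * (trunc_log 2 (2 * T ^ 2) + 2)))%N.
Proof.
move=> D0 N0 sqf s_uniq sP.
case sE: s => [//|[X1 Y1] s']; rewrite -sE.
have [e1 _ _ cop1] : [/\ X1 ^+ 2 - D * Y1 ^+ 2 = N,
  (`|X1| <= T)%N, (`|Y1| <= T)%N & coprimez X1 Y1] by apply: sP; rewrite sE mem_head.
pose q := gcdz N 2.
have qN0 : q * N != 0 by rewrite mulf_neq0 // gcdz_eq0 negb_and N0.
pose g (p : int * int) := `|gcdz (X1 * p.2 - p.1 * Y1) (q * N)|%N.
apply: (@size_le_fibres _ _ g) => [p sp|d _].
  have -> : (gcdn `|N| 2 * `|N|)%N = `|(q * N)%R|%N by rewrite abszM.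
  rewrite -dvdn_divisors ?absz_gt0 //.
  by have := dvdz_gcdr (X1 * p.2 - p.1 * Y1) (q * N); rewrite dvdzE.
rewrite -size_filter; set s2 := [seq _ <- _ | _].
case s2E: s2 => [//|[X2 Y2] s2']; rewrite -s2E.
have : (X2, Y2) \in s2 by rewrite s2E mem_head.
rewrite mem_filter => /andP[/eqP g2 /sP[e2 leX2 leY2 cop2]].
apply: (size_pell_class D0 N0 _ e2 leX2 leY2); first by rewrite filter_uniq.
move=> X Y; rewrite mem_filter => /andP[/eqP gXY /sP[e leX leY cop]]; split=> //.
apply: (cross_dvd sqf N0 _ cop1 cop2 e1 e2 e cop) => //.
by move: g2; rewrite -gXY => /(congr1 Posz); rewrite /g !gez0_abs.
Qed.

Lemma squarefree_part (D : int) : D != 0 ->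
  exists r D0 : int, [/\ D = r ^+ 2 * D0, r != 0 & squarefree D0].
Proof.
move=> D0; pose P r := ((r%:Z) ^+ 2 %| D)%Z.
have exP : exists r, P r by exists 1%N; rewrite /P expr1n dvd1z.
have ubP r : P r -> (r <= `|D|)%N.
  rewrite /P dvdzE abszX /= => /dvdn_leq; rewrite absz_gt0 => /(_ D0) le.
  by apply: leq_trans le; rewrite -mulnn; case: (r) => // k; rewrite leq_pmulr.
case: (ex_maxnP exP ubP) => r /dvdzP[E DE] max.
have r0 : r%:Z != 0 by apply: contraNneq D0 => r0; rewrite DE r0 expr0n mulr0.
exists r%:Z, E; split=> // [|e /dvdzP[f EE]]; first by rewrite mulrC.
have e0 : e != 0 by apply: contraNneq D0 => e0; rewrite DE EE e0 expr0n mulr0 mul0r.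
apply/eqP; rewrite eqn_leq absz_gt0 e0 andbT.
have : (`|e| * r <= r)%N.
  apply: max; rewrite /P DE EE PoszM exprMn abszE real_normK ?num_real //.
  by rewrite -mulrA dvdz_mull.
by case: (r) r0 => // k _; rewrite -{2}[k.+1]mul1n leq_pmul2r.
Qed.

(** Sorting by h = gcd(X, Y), whose square divides N, reduces to coprime solutions for N / h^2: one
    factor d counts the h, the other the classes. The bound S is kept apart from T because
    [size_pell] takes S = T^2. *)
Lemma size_pell_squarefree (D N : int) (T S d : nat) (s : seq (int * int)) :
    D != 0 -> N != 0 -> squarefree D -> uniq s -> (`|N| <= T)%N ->
    (forall n, (0 < n <= 2 * T)%N -> (size (divisors n) <= d)%N) ->
    (forall X Y, (X, Y) \in s -> [/\ X ^+ 2 - D * Y ^+ 2 = N,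
      (`|X| <= S)%N & (`|Y| <= S)%N]) ->
  (size s <= d * (d * (4 * (trunc_log 2 (2 * S ^ 2) + 2))))%N.
Proof.
move=> D0 N0 sqf s_uniq leN led sP.
have N_gt0 : (0 < `|N|)%N by rewrite absz_gt0.
pose g (p : int * int) := gcdn `|p.1| `|p.2|.
apply: (@leq_trans (size (divisors `|N|) *
    (d * (4 * (trunc_log 2 (2 * S ^ 2) + 2))))%N); last first.
  by rewrite leq_mul2r led ?orbT // N_gt0 (leq_trans leN) // leq_pmull.
have gP X Y : (X, Y) \in s -> (0 < g (X, Y))%N /\ ((g (X, Y))%:Z ^+ 2 %| N)%Z.
  move=> /sP[e _ _]; have dvX : ((g (X, Y))%:Z %| X)%Z by rewrite dvdzE dvdn_gcdl.
  have dvY : ((g (X, Y))%:Z %| Y)%Z by rewrite dvdzE dvdn_gcdr.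
  split; last by rewrite -e rpredB ?dvdz_exp2r // dvdz_mull // dvdz_exp2r.
  rewrite gcdn_gt0 !absz_gt0 /=; case: eqP => //= X0; case: eqP => //= Y0.
  by move: N0; rewrite -e X0 Y0 expr0n mulr0 subrr eqxx.
apply: (@size_le_fibres _ _ g) => [[X Y] /gP[_ dv]|h _].
  rewrite -dvdn_divisors //; have : ((g (X, Y))%:Z %| N)%Z.
    by apply: dvdz_trans dv; rewrite expr2 dvdz_mulr.
  by rewrite dvdzE.
rewrite -size_filter; set s2 := [seq _ <- _ | _].
case s2E: s2 => [//|[X2 Y2] s2']; rewrite -s2E.
have : (X2, Y2) \in s2 by rewrite s2E mem_head.
rewrite mem_filter => /andP[/eqP g2 /gP[]]; rewrite g2 => h_gt0 /dvdzP[N' NE].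
have h0 : h%:Z != 0 by rewrite -lt0n.
have N'0 : N' != 0 by apply: contraNneq N0 => N'0; rewrite NE N'0 mul0r.
pose f (p : int * int) := ((p.1 %/ h)%Z, (p.2 %/ h)%Z).
have fP X Y : (X, Y) \in s2 ->
    [/\ X = (f (X, Y)).1 * h, Y = (f (X, Y)).2 * h & (X, Y) \in s].
  rewrite mem_filter => /andP[/eqP gh sXY]; split=> //; rewrite divzK // dvdzE.
    by rewrite -gh dvdn_gcdl.
  by rewrite -gh dvdn_gcdr.
rewrite -(size_map f).
apply: (leq_trans (@size_pell_prim D N' S (map f s2) D0 N'0 sqf _ _)).
- rewrite map_inj_in_uniq ?filter_uniq // => -[X Y] [X' Y'].
  move=> /fP[/= XE YE _] /fP[/= XE' YE' _] [f1 f2].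
  by congr (_, _); [rewrite XE f1 -XE' | rewrite YE f2 -YE'].
- move=> a b /mapP[[X Y] sXY fE]; move: (sXY); rewrite mem_filter.
  move=> /andP[/eqP gh _]; have [XE YE /sP[e leX leY]] := fP _ _ sXY.
  rewrite -fE /= in XE YE; split.
  + have h20 : h%:Z ^+ 2 != 0 by rewrite expf_neq0.
    by apply: (mulIf h20); rewrite -NE -e XE YE; ring.
  + by apply: leq_trans leX; rewrite XE abszM leq_pmulr.
  + by apply: leq_trans leY; rewrite YE abszM leq_pmulr.
  + rewrite coprimezE /coprime -(eqn_pmul2r h_gt0) mul1n muln_gcdl.
    have <- : `|X|%N = (`|a| * h)%N by rewrite XE abszM.
    have <- : `|Y|%N = (`|b| * h)%N by rewrite YE abszM.
    by apply/eqP.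
rewrite leq_mul2r led ?orbT // muln_gt0 gcdn_gt0 !absz_gt0 N'0 /=.
rewrite leq_mul //; first by rewrite dvdn_leq ?dvdn_gcdr.
by apply: leq_trans leN; rewrite NE abszM leq_pmulr // abszX expn_gt0 h_gt0.
Qed.

(** Writing D = r^2 E with E squarefree turns (X, Y) into a solution (X, r Y) for E. *)
Lemma size_pell (D N : int) (T d : nat) (s : seq (int * int)) :
    D != 0 -> N != 0 -> uniq s -> (`|D| <= T)%N -> (`|N| <= T)%N ->
    (forall n, (0 < n <= 2 * T)%N -> (size (divisors n) <= d)%N) ->
    (forall X Y, (X, Y) \in s -> [/\ X ^+ 2 - D * Y ^+ 2 = N,
      (`|X| <= T)%N & (`|Y| <= T)%N]) ->
  (size s <= d * (d * (4 * (trunc_log 2 (2 * (T ^ 2) ^ 2) + 2))))%N.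
Proof.
move=> D0 N0 s_uniq leD leN led sP.
have [r [E [DE r0 sqf]]] := squarefree_part D0.
have E0 : E != 0 by apply: contraNneq D0 => E0; rewrite DE E0 mulr0.
have ler : (`|r| <= T)%N.
  apply: leq_trans leD; rewrite DE abszM abszX -mulnn -mulnA leq_pmulr //.
  by rewrite muln_gt0 !absz_gt0 r0.
have T_gt0 : (0 < T)%N by apply: leq_trans ler; rewrite absz_gt0.
pose f (p : int * int) := (p.1, r * p.2).
rewrite -(size_map f); apply: (size_pell_squarefree E0 N0 sqf _ leN led).
  by rewrite map_inj_in_uniq // => -[X Y] [X' Y'] _ _ [-> /(mulfI r0) ->].
move=> a b /mapP[[X Y] /sP[e leX leY] [-> ->]] /=; split.
- by rewrite -e DE; ring.
- by rewrite (leq_trans leX) // -mulnn leq_pmulr.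
- by rewrite abszM -mulnn leq_mul.
Qed.

Lemma nat_root k M : (0 < k)%N ->
  exists r : nat, (r ^ k <= M)%N /\ forall j, (j ^ k <= M)%N -> (j <= r)%N.
Proof.
move=> k_gt0; have ex0 : exists j, (j ^ k <= M)%N by exists 0%N; rewrite exp0n.
have ub j : (j ^ k <= M)%N -> (j <= M)%N.
  apply: leq_trans; case: k k_gt0 {ex0} => // k _; case: j => // j.
  by rewrite expnS leq_pmulr // expn_gt0.
by case: (ex_maxnP ex0 ub) => r; exists r.
Qed.

(** As k is arbitrary and the exponent 6 is fixed, this is a bound O(T^eps) stated in natural
    numbers. The two divisor counts contribute T each and the logarithm T^4. *)
Lemma pell_count k : (0 < k)%N ->
  exists C : nat, forall (D N : int) (T : nat) (s : seq (int * int)),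
    D != 0 -> N != 0 -> uniq s -> (`|D| <= T)%N -> (`|N| <= T)%N ->
    (forall X Y, (X, Y) \in s -> [/\ X ^+ 2 - D * Y ^+ 2 = N,
      (`|X| <= T)%N & (`|Y| <= T)%N]) ->
  (size s ^ k <= C * T ^ 6)%N.
Proof.
move=> k_gt0; have [C C_gt0 divC] := divisor_bound k.
exists ((C * 2) ^ 2 * (4 ^ k * (k ^ k * 4)))%N => D N T s D0 N0 s_uniq leD leN sP.
have T_gt0 : (0 < T)%N by apply: leq_trans leD; rewrite absz_gt0.
have [d [dk d_max]] := nat_root (C * 2 * T) k_gt0.
have led n : (0 < n <= 2 * T)%N -> (size (divisors n) <= d)%N.
  move=> /andP[n_gt0 le_n]; apply: d_max; apply: leq_trans (divC _ n_gt0) _.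
  by rewrite -mulnA leq_mul2l le_n orbT.
have Lk : ((trunc_log 2 (2 * (T ^ 2) ^ 2) + 2) ^ k <= k ^ k * 4 * T ^ 4)%N.
  rewrite addn2; apply: leq_trans (expn_succ_le _ _) _.
  rewrite -mulnA leq_mul2l expnS; apply/orP; right.
  rewrite -(mulnA 2 2 (T ^ 4)%N) leq_mul2l /= -[4%N]/(2 * 2)%N expnM.
  by apply: trunc_logP; rewrite // muln_gt0 !expn_gt0 T_gt0.
have le1 := size_pell D0 N0 s_uniq leD leN led sP.
apply: (@leq_trans ((d * (d * (4 * (trunc_log 2 (2 * (T ^ 2) ^ 2) + 2)))) ^ k)%N).
  by rewrite leq_exp2r.
rewrite !expnMn; apply: (@leq_trans
  ((C * 2 * T) * ((C * 2 * T) * (4 ^ k * (k ^ k * 4 * T ^ 4))))%N).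
  by rewrite !leq_mul.
apply: eq_leq; ring.
Qed.

(** * Counting the zeros of one form *)

Definition qval (R : pzRingType) n (A : 'M[R]_n) (x : 'rV[R]_n) : R :=
  (x *m A *m x^T) 0 0.

(* The Schur complement of the entry (i, i), multiplied by that entry so as to
   stay integral; its row and column i are zero. *)
Definition schur (R : pzRingType) n (i : 'I_n) (A : 'M[R]_n) : 'M[R]_n :=
  A i i *: A - col i A *m row i A.

Lemma schurE (R : pzRingType) n (i : 'I_n) (A : 'M[R]_n) j k :
  schur i A j k = A i i * A j k - A j i * A i k.
Proof. by rewrite !mxE big_ord1 !mxE. Qed.

Lemma schur_sym (R : comPzRingType) n (i : 'I_n) (A : 'M[R]_n) :
  A^T = A -> (schur i A)^T = schur i A.
Proof.
move=> symA; have symE j k : A j k = A k j by rewrite -{1}symA mxE.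
apply/matrixP => j k; rewrite mxE !schurE (symE k j) (symE k i) (symE i j).
by congr (_ - _); rewrite mulrC.
Qed.

Lemma schur_row0 (R : comPzRingType) n (i k j : 'I_n) (A : 'M[R]_n) :
  k = i \/ (forall l, A k l = 0) -> schur i A k j = 0.
Proof. by rewrite schurE; case=> [->|Ak]; rewrite ?subrr // !Ak mulr0 mul0r subrr. Qed.

Lemma qvalE (R : comPzRingType) n (A : 'M[R]_n) x :
  qval A x = \sum_i \sum_j x 0 i * A i j * x 0 j.
Proof.
rewrite /qval mxE exchange_big; apply: eq_bigr => j _.
by rewrite !mxE mulr_suml.
Qed.

Definition lform (R : pzRingType) n (A : 'M[R]_n) (i : 'I_n) (x : 'rV[R]_n) : R :=
  \sum_j A i j * x 0 j.

(** Completion of the square in coordinate i, multiplied through by the pivot. *)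
Lemma qval_schur (R : comPzRingType) n (i : 'I_n) (A : 'M[R]_n) x : A^T = A ->
  qval (schur i A) x = A i i * qval A x - lform A i x ^+ 2.
Proof.
move=> symA; have symE j k : A j k = A k j by rewrite -{1}symA mxE.
rewrite /qval /schur mulmxBr mulmxBl -scalemxAr -scalemxAl.
have -> : x *m (col i A *m row i A) *m x^T = (x *m col i A) *m (row i A *m x^T).
  by rewrite !mulmxA.
rewrite [LHS]mxE [X in X + _]mxE [X in _ + X]mxE; congr (_ - _).
rewrite mxE big_ord1 !mxE expr2; congr (_ * _); apply: eq_bigr => j _; rewrite !mxE //.
by rewrite mulrC symE.
Qed.

Lemma qval_local (R : comPzRingType) n (A : 'M[R]_n) (P : pred 'I_n)
    (x y : 'rV[R]_n) : A^T = A ->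
    (forall k l, P k -> A k l = 0) -> (forall k, ~~ P k -> x 0 k = y 0 k) ->
  qval A x = qval A y.
Proof.
move=> symA A0 eq_xy; rewrite !qvalE; apply: eq_bigr => i _; apply: eq_bigr => j _.
have [Pi|nPi] := boolP (P i); first by rewrite A0 // !mulr0 !mul0r.
have [Pj|nPj] := boolP (P j); last by rewrite !eq_xy.
by rewrite -symA mxE A0 // !mulr0 !mul0r.
Qed.

Lemma lform_eq (R : idomainType) n (A : 'M[R]_n) (i j : 'I_n)
    (x y : 'rV[R]_n) : A i j != 0 ->
    lform A i x = lform A i y ->
    (forall k, k != j -> A i k = 0 \/ x 0 k = y 0 k) -> x 0 j = y 0 j.
Proof.
move=> Aij eqL eq_xy; apply: (mulfI Aij); move: eqL; rewrite /lform.
rewrite (bigD1 j) //= [RHS](bigD1 j) //=.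
rewrite (eq_bigr (fun k => A i k * y 0 k)) => [/addIr //|k /eq_xy[->|->] //].
by rewrite !mul0r.
Qed.

Lemma size_le2_sqr (T : eqType) (f : T -> int) (s : seq T) K :
    {in s &, forall x y, f x ^+ 2 = f y ^+ 2} ->
    (forall u, (count (fun x => f x == u) s <= K)%N) ->
  (size s <= 2 * K)%N.
Proof.
case: s => // x0 s' sq leK; set s := x0 :: s' in sq leK *.
apply: (@size_le_fibres _ _ f [:: f x0; - f x0]) => [x sx|u _] //.
have /eqP := sq x x0 sx (mem_head _ _).
by rewrite eqf_sqr !inE.
Qed.

Lemma count_le1 (T : eqType) (P : pred T) (s : seq T) : uniq s ->
  {in s &, forall x y, P x -> P y -> x = y} -> (count P s <= 1)%N.
Proof.
move=> s_uniq inj; rewrite -size_filter.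
case sE: (filter P s) => [//|x s']; rewrite -sE.
have : x \in filter P s by rewrite sE mem_head.
rewrite mem_filter => /andP[Px sx].
apply: (@uniq_leq_size _ _ [:: x]); first by rewrite filter_uniq.
by move=> y; rewrite mem_filter inE => /andP[Py sy]; apply/eqP/inj.
Qed.

Lemma box_list n (P : {pred 'I_n}) (B : nat) : exists L : seq 'rV[int]_n,
  size L = ((2 * B).+1 ^ #|P|)%N /\
  forall y : 'rV[int]_n, (forall j, (`|y ord0 j| <= B)%N) ->
    (\row_j (if P j then y 0 j else 0)) \in L.
Proof.
(* Entries are stored shifted by B, so [z0] encodes the entry 0, and functions equal to [z0] off P
   are the vectors supported on P. *)
pose z0 : 'I_(2 * B).+1 := inord B.
pose F (g : {ffun 'I_n -> 'I_(2 * B).+1}) : 'rV[int]_n :=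
  \row_j ((g j : nat)%:Z - B%:Z).
exists [seq F g | g <- enum (pffun_on z0 P predT)]; split.
  rewrite size_map -cardE card_pffun_on; congr (_ ^ _)%N.
  by rewrite cardT size_enum_ord.
move=> y leB; apply/mapP; pose g : {ffun 'I_n -> 'I_(2 * B).+1} :=
  [ffun j => if P j then inord `|(y ord0 j + B%:Z)%R|%N else z0].
exists g.
  rewrite mem_enum; apply/pffun_onP; split=> //.
  by apply/fintype.subsetP => j; rewrite inE ffunE unfold_in; case: ifP; rewrite ?eqxx.
apply/rowP => j; rewrite !mxE ffunE; have := leB j.
case: ifP => _ le; rewrite /z0 inordK ?subrr //; last by lia.
  by move: le; move: (y _ _) => a; lia.
by move: le; move: (y _ _) => a; lia.
Qed.

Definition ix0 m : 'I_m.+3 := @Ordinal m.+3 0 isT.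
Definition ix1 m : 'I_m.+3 := @Ordinal m.+3 1 isT.
Definition ix2 m : 'I_m.+3 := @Ordinal m.+3 2 isT.

(* Up to powers of its predecessors each factor is the next leading principal
   minor of A. *)
Definition pivots (R : pzRingType) m (A : 'M[R]_m.+3) : R :=
  A (ix0 m) (ix0 m) * schur (ix0 m) A (ix1 m) (ix1 m) *
  schur (ix1 m) (schur (ix0 m) A) (ix2 m) (ix2 m).

Lemma absz_lform n (A : 'M[int]_n) i (y : 'rV[int]_n) (H B : nat) :
    (forall j k, (`|A j k| <= H)%N) -> (forall j, (`|y ord0 j| <= B)%N) ->
  (`|lform A i y| <= n * (H * B))%N.
Proof.
move=> leH leB; rewrite /lform -lez_nat abszE.
apply: le_trans (ler_norm_sum _ _ _) _.
apply: (@le_trans _ _ (\sum_(j < n) (H * B)%N%:Z)); last first.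
  by rewrite sumr_const card_ord -mulr_natl natz -PoszM.
by apply: ler_sum => j _; rewrite -abszE abszM lez_nat leq_mul.
Qed.

Lemma absz_qval n (A : 'M[int]_n) (y : 'rV[int]_n) (H B : nat) :
    (forall j k, (`|A j k| <= H)%N) -> (forall j, (`|y ord0 j| <= B)%N) ->
  (`|qval A y| <= n * (n * (H * B)) * B)%N.
Proof.
move=> leH leB.
have -> : qval A y = \sum_i y 0 i * lform A i y.
  rewrite qvalE; apply: eq_bigr => i _; rewrite mulr_sumr.
  by apply: eq_bigr => j _; rewrite mulrA.
rewrite -lez_nat abszE; apply: le_trans (ler_norm_sum _ _ _) _.
apply: (@le_trans _ _ (\sum_(j < n) (n * (H * B) * B)%N%:Z)); last first.
  by rewrite sumr_const card_ord -mulr_natl natz -PoszM !mulnA.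
apply: ler_sum => j _; rewrite -abszE abszM lez_nat mulnC leq_mul //.
exact: absz_lform.
Qed.

Lemma absz_schur n (A : 'M[int]_n) i (H : nat) :
    (forall j k, (`|A j k| <= H)%N) ->
  forall j k, (`|schur i A j k| <= 2 * H ^ 2)%N.
Proof.
move=> leH j k; rewrite schurE.
apply: (@leq_trans (`|A i i| * `|A j k| + `|A j i| * `|A i k|)%N).
  by rewrite -!abszM; move: (A i i * _) (A j i * _) => x y; clear; lia.
by rewrite mul2n -addnn -mulnn leq_add // leq_mul.
Qed.

Section Count.
Variables (m : nat) (A : 'M[int]_m.+3).
Hypothesis symA : A^T = A.
Hypothesis pivA : pivots A != 0.

Local Notation i0 := (ix0 m).
Local Notation i1 := (ix1 m).
Local Notation i2 := (ix2 m).
Local Notation A1 := (schur i0 A).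
Local Notation A2 := (schur i1 A1).
Local Notation A3 := (schur i2 A2).

Let symA1 : A1^T = A1. Proof. exact: schur_sym. Qed.
Let symA2 : A2^T = A2. Proof. exact: schur_sym. Qed.
Let symA3 : A3^T = A3. Proof. exact: schur_sym. Qed.

Let piv : [/\ A i0 i0 != 0, A1 i1 i1 != 0 & A2 i2 i2 != 0].
Proof. by move: pivA; rewrite /pivots !mulf_eq0 !negb_or -andbA => /and3P. Qed.

Let A1_row0 k : A1 i0 k = 0. Proof. by apply: schur_row0; left. Qed.
Let A2_row0 k : A2 i0 k = 0. Proof. by apply: schur_row0; right. Qed.
Let A2_row1 k : A2 i1 k = 0. Proof. by apply: schur_row0; left. Qed.
Let A3_row0 k : A3 i0 k = 0. Proof. by apply: schur_row0; right. Qed.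
Let A3_row1 k : A3 i1 k = 0. Proof. by apply: schur_row0; right. Qed.
Let A3_row2 k : A3 i2 k = 0. Proof. by apply: schur_row0; left. Qed.

(** The Pell equation obtained by completing squares at i0 and i1. Its right side ignores the
    coordinates i0 and i1, since these rows of [A2] vanish. *)
Let norm_eq y : qval A y = 0 ->
  lform A1 i1 y ^+ 2 - (- A1 i1 i1) * lform A i0 y ^+ 2 = - qval A2 y.
Proof. by move=> Q0; rewrite !qval_schur // Q0; ring. Qed.

(** Fixing all coordinates except i0 and i1 fixes N. Then (X, Y) determines y: [lform A1 i1] does
    not involve the coordinate i0 and yields the coordinate i1, after which [lform A i0] yields the
    coordinate i0. *)
Lemma count_nondegenerate (s : seq 'rV[int]_m.+3) (H B K : nat) : uniq s ->
    (0 < H)%N -> (0 < B)%N ->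
    (forall j k, (`|A j k| <= H)%N) ->
    (forall y, y \in s -> [/\ qval A y = 0, qval A2 y != 0 &
       forall j, (`|y ord0 j| <= B)%N]) ->
    (forall (D N : int) (T : nat) (s' : seq (int * int)), D != 0 -> N != 0 -> uniq s' ->
      T = (8 * m.+3 ^ 2 * H ^ 4 * B ^ 2)%N -> (`|D| <= T)%N -> (`|N| <= T)%N ->
      (forall X Y, (X, Y) \in s' -> [/\ X ^+ 2 - D * Y ^+ 2 = N,
        (`|X| <= T)%N & (`|Y| <= T)%N]) -> (size s' <= K)%N) ->
  (size s <= (2 * B).+1 ^ m.+1 * K)%N.
Proof.
move=> s_uniq H_gt0 B_gt0 leH sP leK.
have [L [sizeL LP]] := box_list (predC (pred2 i0 i1)) B.
have cardP : #|predC (pred2 i0 i1)| = m.+1.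
  by apply/eqP; rewrite -(eqn_add2l #|pred2 i0 i1|) cardC card_ord card2.
rewrite cardP in sizeL; rewrite -sizeL.
apply: (@size_le_fibres _ _ (fun y : 'rV[int]_m.+3 =>
  \row_j (if (predC (pred2 i0 i1)) j then y 0 j else 0))) => [y /sP[_ _ leB]|u _].
  exact: LP.
rewrite -size_filter; set s' := filter _ _.
case s'E: s' => [//|y0 s'']; rewrite -s'E.
have s'P y : y \in s' -> y \in s /\ (forall j, j != i0 -> j != i1 -> y 0 j = u 0 j).
  rewrite mem_filter => /andP[/eqP <- ->]; split => // j j0 j1.
  by rewrite mxE inE /= (negPf j0) (negPf j1).
have [] := s'P y0; first by rewrite s'E mem_head.
move=> /sP[Q0 N0 leB0] y0u.
have agree y : y \in s' -> forall j, ~~ pred2 i0 i1 j -> y 0 j = y0 0 j.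
  move=> /s'P[_ yu] j; rewrite inE negb_or => /andP[j0 j1].
  by rewrite yu // y0u.
have eqN y : y \in s' -> qval A2 y = qval A2 y0.
  move=> s'y; apply: (qval_local (P := pred2 i0 i1)) symA2 _ (agree _ s'y).
  by move=> k l /orP[/eqP ->|/eqP ->].
pose f y := (lform A1 i1 y, lform A i0 y).
have [a0 b0 _] := piv.
have le_n : (m.+3 <= m.+3 ^ 2)%N by rewrite -mulnn leq_pmulr.
have le_H2 : (H <= H ^ 2)%N by rewrite -mulnn leq_pmulr.
have le_H4 : (H ^ 2 <= H ^ 4)%N by rewrite leq_pexp2l.
have le_B2 : (B <= B ^ 2)%N by rewrite -mulnn leq_pmulr.
rewrite -(size_map f); apply: (leK (- A1 i1 i1) (- qval A2 y0)) (erefl _) _ _ _.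
- by rewrite oppr_eq0.
- by rewrite oppr_eq0.
- rewrite map_inj_in_uniq ?filter_uniq // => y z s'y s'z [e1 e0].
  have eq1 : y 0 i1 = z 0 i1.
    apply: (lform_eq b0 e1) => k k1; have [->|k0] := eqVneq k i0.
      by left; rewrite -symA1 mxE A1_row0.
    by right; rewrite !agree //= negb_or k0.
  have eq0 : y 0 i0 = z 0 i0.
    apply: (lform_eq a0 e0) => k k0; right; have [->//|k1] := eqVneq k i1.
    by rewrite !agree //= negb_or k0.
  apply/rowP => k; have [->//|k0] := eqVneq k i0; have [->//|k1] := eqVneq k i1.
  by rewrite !agree //= negb_or k0.
- rewrite abszN; apply: leq_trans (absz_schur _ leH _ _) _.
  rewrite -[(2 * _)%N]muln1; apply: leq_mul; last by rewrite expn_gt0 B_gt0.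
  by rewrite leq_mul.
(* This bound dictates T: entries of [A1] are at most 2 H^2, those of [A2] at most 8 H^4. *)
- rewrite abszN; apply: leq_trans (absz_qval (absz_schur _ (absz_schur _ leH)) leB0) _.
  apply: eq_leq; ring.
move=> X Y /mapP[y s'y [-> ->]]; have [/sP[Qy _ leBy] _] := s'P y s'y.
split; first by rewrite norm_eq // eqN.
- apply: leq_trans (absz_lform _ (absz_schur _ leH) leBy) _.
  apply: (@leq_trans (2 * m.+3 * H ^ 2 * B)%N); first by apply: eq_leq; ring.
  by do 3!apply: leq_mul => //.
apply: leq_trans (absz_lform _ leH leBy) _.
apply: (@leq_trans (1 * m.+3 * H * B)%N); first by apply: eq_leq; ring.
have le_HH := leq_trans le_H2 le_H4.
by do 3!apply: leq_mul => //.
Qed.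

(** Now all coordinates but i0 and i2 are fixed. The square of [lform A2 i2] is then a constant,
    which leaves two values for the coordinate i2; with these known, so is [lform A1 i1], and the
    Pell equation with N = 0 leaves two values for the coordinate i0. *)
Lemma count_degenerate (s : seq 'rV[int]_m.+3) (B : nat) : uniq s ->
    (forall y, y \in s -> [/\ qval A y = 0, qval A2 y = 0 &
       forall j, (`|y ord0 j| <= B)%N]) ->
  (size s <= (2 * B).+1 ^ m.+1 * 4)%N.
Proof.
move=> s_uniq sP.
have [L [sizeL LP]] := box_list (predC (pred2 i0 i2)) B.
have cardP : #|predC (pred2 i0 i2)| = m.+1.
  by apply/eqP; rewrite -(eqn_add2l #|pred2 i0 i2|) cardC card_ord card2.
rewrite cardP in sizeL; rewrite -sizeL.
apply: (@size_le_fibres _ _ (fun y : 'rV[int]_m.+3 =>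
  \row_j (if (predC (pred2 i0 i2)) j then y 0 j else 0))) => [y /sP[_ _ leB]|u _].
  exact: LP.
rewrite -size_filter; set s' := filter _ _.
have s'_uniq : uniq s' by rewrite filter_uniq.
have s'P y : y \in s' -> y \in s /\ (forall j, j != i0 -> j != i2 -> y 0 j = u 0 j).
  rewrite mem_filter => /andP[/eqP <- ->]; split => // j j0 j1.
  by rewrite mxE inE /= (negPf j0) (negPf j1).
have agree y z : y \in s' -> z \in s' -> forall j, j != i0 -> j != i2 -> y 0 j = z 0 j.
  by move=> /s'P[_ yu] /s'P[_ zu] j j0 j2; rewrite yu // zu.
have [a0 b0 c0] := piv.
rewrite -[4%N]/(2 * 2)%N.
apply: (@size_le2_sqr _ (lform A2 i2)) => [y z s'y s'z|v].
  have sq x : x \in s' -> lform A2 i2 x ^+ 2 = - qval A3 x.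
    by move=> /s'P[/sP[_ Q2 _] _]; rewrite (qval_schur _ _ symA2) Q2; ring.
  rewrite !sq //; congr (- _).
  apply: (qval_local (P := [pred k | [|| k == i0, k == i1 | k == i2]])) => //.
    by move=> k l /or3P[] /eqP ->.
  by move=> k /norP[k0 /norP[_ k2]]; apply: agree.
rewrite -size_filter.
have agree2 y z : y \in s' -> z \in s' -> lform A2 i2 y = lform A2 i2 z ->
    forall j, j != i0 -> y 0 j = z 0 j.
  move=> s'y s'z e j j0; have [->|] := eqVneq j i2; last exact: agree.
  apply: (lform_eq c0 e) => k k2; have [->|k0] := eqVneq k i0.
    by left; rewrite -symA2 mxE A2_row0.
  by right; apply: agree.
rewrite -[2%N]/(2 * 1)%N; apply: (@size_le2_sqr _ (lform A i0)) => [y z|w].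
  rewrite mem_filter => /andP[/eqP yv s'y]; rewrite mem_filter => /andP[/eqP zv s'z].
  apply: (mulfI b0).
  have sq x : x \in s' -> A1 i1 i1 * lform A i0 x ^+ 2 = - lform A1 i1 x ^+ 2.
    move=> /s'P[/sP[Q0 Q2 _] _]; have := norm_eq Q0; rewrite Q2 oppr0.
    by rewrite mulNr opprK => /eqP; rewrite addr_eq0 => /eqP ->; rewrite opprK.
  rewrite (sq y) // (sq z) //.
  suff -> : lform A1 i1 y = lform A1 i1 z by [].
  apply: eq_bigr => k _.
  have [->|k0] := eqVneq k i0; first by rewrite -symA1 mxE A1_row0 !mul0r.
  by congr (_ * _); apply: agree2 => //; rewrite yv zv.
apply: count_le1 => [|y z]; first by rewrite filter_uniq.
rewrite mem_filter => /andP[/eqP yv s'y]; rewrite mem_filter => /andP[/eqP zv s'z].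
move=> /eqP yw /eqP zw.
have eqk k : k != i0 -> y 0 k = z 0 k by apply: agree2 => //; rewrite yv zv.
apply/rowP => k; have [->|/eqk //] := eqVneq k i0.
have e0 : lform A i0 y = lform A i0 z by rewrite yw zw.
by apply: (lform_eq a0 e0) => j /eqk; right.
Qed.

End Count.

Lemma count_zeros m k : (0 < k)%N ->
  exists C : nat, forall (A : 'M[int]_m.+3) (H B : nat) (s : seq 'rV[int]_m.+3),
    A^T = A -> pivots A != 0 -> (0 < H)%N -> (0 < B)%N -> uniq s ->
    (forall i j, (`|A i j| <= H)%N) ->
    (forall y, y \in s -> qval A y = 0 /\ forall j, (`|y ord0 j| <= B)%N) ->
  (size s ^ k <= C * B ^ (m.+1 * k) * (H ^ 4 * B ^ 2) ^ 6)%N.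
Proof.
move=> k_gt0; have [C pellC] := pell_count k_gt0.
exists ((3 ^ m.+1) ^ k * 5 ^ k * (C.+1 * (8 * m.+3 ^ 2) ^ 6))%N.
move=> A H B s symA pivA H_gt0 B_gt0 s_uniq leH sP.
have [T TE] : exists T, T = (8 * m.+3 ^ 2 * H ^ 4 * B ^ 2)%N by eexists.
have T_gt0 : (0 < T)%N by rewrite TE !muln_gt0 H_gt0 B_gt0.
(* Using [C.+1] in place of [C] makes K positive, so that 4 + K <= 5 K below. *)
have [K [Kk Kmax]] := nat_root (C.+1 * T ^ 6) k_gt0.
have K_gt0 : (0 < K)%N.
  apply: Kmax; rewrite exp1n; have : (0 < T ^ 6)%N by rewrite expn_gt0 T_gt0.
  by move: (T ^ 6)%N => t; nia.
pose P y := qval (schur (ix1 m) (schur (ix0 m) A)) y == 0.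
have le0 : (size (filter P s) <= (2 * B).+1 ^ m.+1 * 4)%N.
  apply: (count_degenerate symA pivA); first by rewrite filter_uniq.
  by move=> y; rewrite mem_filter => /andP[/eqP Q2 /sP[]].
have le1 : (size (filter (predC P) s) <= (2 * B).+1 ^ m.+1 * K)%N.
  apply: (count_nondegenerate symA pivA _ H_gt0 B_gt0 leH).
  - by rewrite filter_uniq.
  - by move=> y; rewrite mem_filter => /andP[/= Q2 /sP[]].
  move=> D N T' s' D0 N0 s'_uniq; rewrite -TE => -> leD leN s'P; apply: Kmax.
  apply: leq_trans (pellC D N T s' D0 N0 s'_uniq leD leN s'P) _.
  by rewrite leq_mul2r leqnSn orbT.
have le : (size s <= (3 ^ m.+1 * B ^ m.+1) * (5 * K))%N.
  apply: (@leq_trans ((2 * B).+1 ^ m.+1 * 4 + (2 * B).+1 ^ m.+1 * K)%N).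
    by rewrite -(count_predC P) -!size_filter leq_add.
  rewrite -mulnDr; apply: leq_mul; last by move: K_gt0; clear; lia.
  rewrite -[leqRHS]expnMn leq_exp2r //; move: B_gt0; clear; lia.
apply: (@leq_trans (((3 ^ m.+1 * B ^ m.+1) * (5 * K)) ^ k)%N).
  by rewrite leq_exp2r.
rewrite !expnMn -(expnM B).
apply: (@leq_trans ((3 ^ m.+1) ^ k * B ^ (m.+1 * k) * (5 ^ k * (C.+1 * T ^ 6)))%N).
  by do 2!apply: leq_mul => //.
rewrite TE !expnMn; apply: eq_leq; ring.
Qed.

(** * Replacing the form by one with small coefficients *)

(* The degree bound is uniform over all lines, which keeps the constants
   independent of the form. *)
Definition polyfun (V : lmodType int) (d : nat) (f : V -> int) :=
  forall u w : V, exists2 p : {poly int}, (size p <= d.+1)%N &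
    forall t : int, f (u + t *: w) = p.[t].

Section PolyFun.
Variable V : lmodType int.
Implicit Types (f g : V -> int) (d e : nat).

Lemma eq_polyfun d f g : f =1 g -> polyfun d f -> polyfun d g.
Proof.
by move=> efg pf u w; have [p sp pE] := pf u w; exists p => // t; rewrite -efg.
Qed.

Lemma polyfun_const d c : polyfun d (fun _ : V => c).
Proof.
move=> u w; exists c%:P => [|t]; last by rewrite hornerC.
by rewrite (leq_trans (size_polyC_leq1 _)).
Qed.

Lemma polyfun_add d f g : polyfun d f -> polyfun d g -> polyfun d (fun v => f v + g v).
Proof.
move=> pf pg u w; have [p sp pE] := pf u w; have [q sq qE] := pg u w.
exists (p + q) => [|t]; last by rewrite hornerD pE qE.
by rewrite (leq_trans (size_polyD _ _)) // geq_max sp.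
Qed.

Lemma polyfun_mul d e f g :
  polyfun d f -> polyfun e g -> polyfun (d + e) (fun v => f v * g v).
Proof.
move=> pf pg u w; have [p sp pE] := pf u w; have [q sq qE] := pg u w.
exists (p * q) => [|t]; last by rewrite hornerM pE qE.
by rewrite (leq_trans (size_polyMleq _ _)) //; lia.
Qed.

Lemma polyfun_scale d c f : polyfun d f -> polyfun d (fun v => c * f v).
Proof. by move=> pf; rewrite -[d]add0n; apply: polyfun_mul (polyfun_const _ _) pf. Qed.

Lemma polyfun_sub d f g : polyfun d f -> polyfun d g -> polyfun d (fun v => f v - g v).
Proof.
move=> pf pg; apply: eq_polyfun (polyfun_add pf (polyfun_scale (-1) pg)) => v.
by rewrite mulN1r.
Qed.

Lemma polyfun_sum d (I : Type) (r : seq I) (F : I -> V -> int) :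
  (forall i, polyfun d (F i)) -> polyfun d (fun v => \sum_(i <- r) F i v).
Proof.
move=> pF; elim: r => [|i r IHr].
  by apply: eq_polyfun (polyfun_const _ 0) => v; rewrite big_nil.
by apply: eq_polyfun (polyfun_add (pF i) IHr) => v; rewrite big_cons.
Qed.

Lemma polyfun_prod d (I : Type) (r : seq I) (F : I -> V -> int) :
  (forall i, polyfun d (F i)) -> polyfun (size r * d) (fun v => \prod_(i <- r) F i v).
Proof.
move=> pF; elim: r => [|i r IHr].
  by apply: eq_polyfun (polyfun_const _ 1) => v; rewrite big_nil.
rewrite /= mulSn.
by apply: eq_polyfun (polyfun_mul (pF i) IHr) => v; rewrite big_cons.
Qed.

Lemma polyfun_linear f : (forall t u w, f (u + t *: w) = f u + t * f w) -> polyfun 1 f.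
Proof.
move=> lin u w; exists ((f u)%:P + f w *: 'X) => [|t]; last first.
  by rewrite lin hornerD hornerC hornerZ hornerX mulrC.
rewrite (leq_trans (size_polyD _ _)) // geq_max (leq_trans (size_polyC_leq1 _)) //.
by rewrite (leq_trans (size_scale_leq _ _)) // size_polyX.
Qed.

Lemma poly_small_nonroot d (p : {poly int}) t :
  (size p <= d.+1)%N -> p.[t] != 0 -> exists2 n, (n <= d)%N & p.[n%:Z] != 0.
Proof.
move=> sp pt; have p0 : p != 0 by apply: contraNneq pt => ->; rewrite horner0.
pose rs := [seq n%:Z | n <- iota 0 d.+1].
have [/(max_poly_roots p0)|/allPn[z /mapP[n]]] := boolP (all (root p) rs).
  rewrite map_inj_uniq ?iota_uniq; last by move=> a b [].
  by move=> /(_ isT); rewrite size_map size_iota ltnNge sp.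
by rewrite mem_iota ltnS => le_nd -> pn; exists n.
Qed.

(** Coefficients are replaced one at a time: in a single coefficient f is a nonzero polynomial of
    degree at most d, so one of 0, ..., d is not a root. Terms already treated move into u. *)
Lemma polyfun_small d f (L : seq (int * V)) u : polyfun d f ->
    f (u + \sum_(p <- L) p.1 *: p.2) != 0 ->
  exists L' : seq (int * V), [/\ map snd L' = map snd L,
    (forall p, p \in L' -> (`|p.1| <= d)%N) &
    f (u + \sum_(p <- L') p.1 *: p.2) != 0].
Proof.
move=> pf; elim: L u => [|[t w] L IHL] u; first by exists nil.
rewrite big_cons /= addrCA addrC.
have [p sp pE] := pf (u + \sum_(j <- L) j.1 *: j.2) w.
rewrite pE => /(poly_small_nonroot sp)[n le_nd].
rewrite -pE addrAC => /IHL[L' [mapL' smallL' nz]].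
exists ((n%:Z, w) :: L'); split => [|q|]; first by rewrite /= mapL'.
  by rewrite inE => /predU1P[->|/smallL'].
by rewrite big_cons /= addrA.
Qed.

(** On the line through u and w both functions are nonzero polynomials, so their product has
    finitely many roots. *)
Lemma polyfun_common d e f g u w : polyfun d f -> polyfun e g ->
  f u != 0 -> g w != 0 -> exists v, f v * g v != 0.
Proof.
move=> pf pg fu gw.
have [p _ pE] := pf u (w - u); have [q _ qE] := pg u (w - u).
have p0 : p != 0.
  apply: contraNneq fu => p0; rewrite -[u]addr0 -(scale0r (w - u)) pE p0.
  by rewrite horner0.
have q0 : q != 0.
  apply: contraNneq gw => q0; have := qE 1; rewrite scale1r addrC subrK => ->.
  by rewrite q0 horner0.
have pq0 : p * q != 0 by rewrite mulf_neq0.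
pose rs := [seq n%:Z | n <- iota 0 (size (p * q))].
have [/(max_poly_roots pq0)|/allPn[z _ pqz]] := boolP (all (root (p * q)) rs).
  rewrite map_inj_uniq ?iota_uniq; last by move=> a b [].
  by move=> /(_ isT); rewrite size_map size_iota ltnn.
by exists (u + z *: (w - u)); rewrite pE qE -hornerM.
Qed.

Lemma polyfun_schur n d (M : V -> 'M[int]_n) i :
    (forall j k, polyfun d (fun v => M v j k)) ->
  forall j k, polyfun (2 * d) (fun v => schur i (M v) j k).
Proof.
move=> pM j k; rewrite mul2n -addnn.
apply: (eq_polyfun (f := fun v => M v i i * M v j k - M v j i * M v i k)).
  by move=> v; rewrite schurE.
by apply: polyfun_sub; apply: polyfun_mul.
Qed.

Lemma polyfun_pivots m d (M : V -> 'M[int]_m.+3) :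
    (forall j k, polyfun d (fun v => M v j k)) ->
  polyfun (7 * d) (fun v => pivots (M v)).
Proof.
move=> pM; have -> : (7 * d = d + 2 * d + 2 * (2 * d))%N by lia.
by do 2?apply: polyfun_mul => //; do 2?apply: polyfun_schur.
Qed.

Lemma polyfun_det n d (M : V -> 'M[int]_n) :
    (forall j k, polyfun d (fun v => M v j k)) ->
  polyfun (n * d) (fun v => \det (M v)).
Proof.
move=> pM; apply: polyfun_sum => s; apply: polyfun_scale.
have -> : (n * d = size (index_enum 'I_n) * d)%N.
  by rewrite -[index_enum _]enumT size_enum_ord.
exact: polyfun_prod.
Qed.

End PolyFun.

Lemma polyfun_entry m n (i : 'I_m) (j : 'I_n) :
  polyfun 1 (fun M : 'M[int]_(m, n) => M i j).
Proof. by apply: polyfun_linear => t u w; rewrite !mxE. Qed.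

Lemma polyfun_congr n (A : 'M[int]_n) i j :
  polyfun 2 (fun U : 'M[int]_n => (U *m A *m U^T) i j).
Proof.
have pf : polyfun 2 (fun U : 'M[int]_n => \sum_k \sum_l A l k * (U i l * U j k)).
  do 2!apply: polyfun_sum => ?; apply: polyfun_scale.
  by apply: (@polyfun_mul _ 1 1); apply: polyfun_entry.
apply: eq_polyfun pf => U; rewrite mxE; apply: eq_bigr => k _; rewrite !mxE mulr_suml.
by apply: eq_bigr => l _; ring.
Qed.

Lemma qval_lin (R : comPzRingType) n (a b : R) (A C : 'M[R]_n) x :
  qval (a *: A + b *: C) x = a * qval A x + b * qval C x.
Proof.
rewrite /qval mulmxDr mulmxDl -!scalemxAr -!scalemxAl mxE.
by rewrite [X in X + _]mxE [X in _ + X]mxE.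
Qed.

Lemma qval_scale (R : comPzRingType) n (a : R) (A : 'M[R]_n) x :
  qval (a *: A) x = a * qval A x.
Proof. by rewrite /qval -!scalemxAr -!scalemxAl mxE. Qed.

Lemma qval_tr (R : comPzRingType) n (A : 'M[R]_n) x : qval A^T x = qval A x.
Proof.
rewrite !qvalE exchange_big; apply: eq_bigr => i _; apply: eq_bigr => j _.
by rewrite mxE; ring.
Qed.

Lemma qval_sum (R : comPzRingType) n (L : seq (R * 'M[R]_n)) x :
  qval (\sum_(p <- L) p.1 *: p.2) x = \sum_(p <- L) p.1 * qval p.2 x.
Proof.
rewrite /qval mulmx_sumr mulmx_suml summxE; apply: eq_bigr => p _.
by rewrite -!scalemxAr -!scalemxAl mxE.
Qed.

(* Imposing one more vanishing condition removes a member of the spanning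
   family and squares the size of the others; as there are only n^2 members,
   the final size is a power of B that does not depend on the length of S. *)
Lemma vanishing_family n (B : nat) (S : seq 'rV[int]_n) (M0 : 'M[int]_n) :
    (forall x, x \in S -> qval M0 x = 0 /\ forall j, (`|x ord0 j| <= B)%N) ->
  exists (c : int) (L : seq (int * 'M[int]_n)), [/\ c != 0, (size L <= n * n)%N,
    c *: M0 = \sum_(p <- L) p.1 *: p.2 &
    forall p, p \in L -> (forall x, x \in S -> qval p.2 x = 0) /\
      forall i j,
        (`|p.2 i j| <= (2 * (n * n * (B * B))) ^ (2 ^ (n * n - size L) - 1))%N].
Proof.
set b := (2 * _)%N; elim: S => [_|x S IHS SP].
  exists 1, [seq (M0 i j, delta_mx i j) | i <- enum 'I_n, j <- enum 'I_n].
  rewrite size_allpairs size_enum_ord subnn; split => //.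
    rewrite scale1r {1}(matrix_sum_delta M0) big_allpairs_dep big_enum /=.
    by apply: eq_bigr => i _; rewrite big_enum.
  move=> p /allpairsP[[i j] /= [_ _ ->]] /=; split => // i' j'.
  by rewrite mxE; case: (_ && _).
have [Qx leB] := SP x (mem_head _ _).
have {}[|c [L [c0 sizeL cM LP]]] := IHS.
  by move=> y Sy; apply: SP; rewrite inE Sy orbT.
have [|/allPn[p0 Lp0 p0x]] := boolP (all (fun p => qval p.2 x == 0) L).
  move=> /allP L0; exists c, L; split=> // p Lp; have [pS pB] := LP p Lp.
  by split=> // y; rewrite inE => /predU1P[->|/pS //]; apply/eqP/L0.
have [p0S p0B] := LP p0 Lp0.
move: cM LP sizeL p0B; case/splitPr: Lp0 => L1 L2 cM LP sizeL p0B.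
(* Subtracting a multiple of [p0.2] makes every member vanish at x. The same coefficients now
   represent a c M0, because the corrections add up to c times [qval M0 x], which is 0. *)
pose a := qval p0.2 x.
pose f (p : int * 'M[int]_n) := (p.1, a *: p.2 + (- qval p.2 x) *: p0.2).
have sizeE : size (L1 ++ p0 :: L2) = (size (map f (L1 ++ L2))).+1.
  by rewrite size_map !size_cat addnS.
exists (a * c), (map f (L1 ++ L2)); split.
- by rewrite mulf_neq0.
- by rewrite (leq_trans _ sizeL) // sizeE.
- have sum0 : \sum_(p <- L1 ++ p0 :: L2) p.1 * qval p.2 x = 0.
    by rewrite -qval_sum -cM qval_scale Qx mulr0.
  rewrite -scalerA cM big_map /= scaler_sumr.
  transitivity (\sum_(p <- L1 ++ p0 :: L2) p.1 *: (f p).2).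
    have e0 := congr1 (fun t => t *: p0.2) sum0; rewrite /= scale0r scaler_suml in e0.
    rewrite -[RHS]addr0 -[X in _ = _ + X]e0 -big_split /=.
    apply: eq_bigr => p _; rewrite scalerDr !scalerA mulrN scaleNr subrK.
    by rewrite mulrC.
  rewrite !big_cat /= big_cons /f /= -/a scaleNr subrr scaler0 add0r.
  by [].
move=> q /mapP[p Lp ->] /=.
have {}Lp : p \in L1 ++ p0 :: L2.
  by move: Lp; rewrite !mem_cat inE => /orP[] ->; rewrite ?orbT.
have [pS pB] := LP p Lp; split=> [y|i j].
  rewrite inE => /predU1P[->|Sy]; rewrite qval_lin; first by rewrite /a; ring.
  by rewrite pS // p0S // !mulr0 addr0.
set e := (n * n - size (L1 ++ p0 :: L2))%N in p0B pB.
have -> : (n * n - size (map f (L1 ++ L2)) = e.+1)%N.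
  by rewrite /e sizeE subnSK // -sizeE.
set h := (b ^ (2 ^ e - 1))%N in p0B pB.
have -> : (b ^ (2 ^ e.+1 - 1) = b * h ^ 2)%N.
  rewrite /h -[in RHS]expnM -[RHS]expnS; congr (b ^ _)%N; rewrite expnS.
  by have := expn_gt0 2 e; move: (2 ^ e)%N => t; clear; lia.
have bound (M : 'M[int]_n) (t : int) : (forall i j, (`|M i j| <= h)%N) ->
    (`|t| <= h)%N -> (`|(qval M x * t)%R| <= n * n * (B * B) * h ^ 2)%N.
  move=> leM let_h; rewrite abszM.
  apply: leq_trans (leq_mul (absz_qval leM leB) let_h) _.
  by apply: eq_leq; ring.
rewrite mxE [X in (X + _)%R]mxE [X in (_ + X)%R]mxE.
apply: (@leq_trans (`|(a * p.2 i j)%R| + `|(qval p.2 x * p0.2 i j)%R|)%N).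
  by rewrite mulNr; move: (a * _) (_ * p0.2 i j) => u v; clear; lia.
by rewrite /b mul2n -addnn mulnDl leq_add // bound.
Qed.

Lemma schur_scale (R : comPzRingType) n (i : 'I_n) (t : R) (A : 'M[R]_n) :
  schur i (t *: A) = t ^+ 2 *: schur i A.
Proof.
by apply/matrixP => j k; rewrite [in RHS]mxE !schurE !mxE; ring.
Qed.

Lemma pivots_scale m (t : int) (A : 'M[int]_m.+3) : pivots (t *: A) = t ^+ 7 * pivots A.
Proof.
rewrite /pivots !schur_scale ![(_ *: _ : 'M_ _) _ _]mxE.
by move: (A _ _) (schur _ A _ _) (schur _ (schur _ A) _ _) => a b c; ring.
Qed.

Lemma small_form m : exists C E : nat, forall (B : nat) (S : seq 'rV[int]_m.+3)
    (M0 : 'M[int]_m.+3), (0 < B)%N -> M0^T = M0 -> pivots M0 != 0 ->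
    (forall x, x \in S -> qval M0 x = 0 /\ forall j, (`|x ord0 j| <= B)%N) ->
  exists A : 'M[int]_m.+3, [/\ A^T = A, pivots A != 0,
    forall x, x \in S -> qval A x = 0 &
    forall i j, (`|A i j| <= C * B ^ E)%N].
Proof.
set n := m.+3; set e := (2 ^ (n * n))%N.
(* There are two summands in M + M^T, at most n^2 members, coefficients at most 7, and members of
   size at most (2 n^2 B^2)^e. *)
exists (2 * (n * n * (7 * (2 * (n * n)) ^ e)))%N, (2 * e)%N.
move=> B S M0 B_gt0 symM0 piv0 SP.
have [c [L [c0 sizeL cM LP]]] := vanishing_family SP.
(* The members of L need not be symmetric; at c M0 the symmetrization only produces the factor 2
   c. *)
pose f (M : 'M[int]_n) := pivots (M + M^T).
have pf : polyfun 7 f.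
  apply: (@polyfun_pivots _ m 1 (fun M => M + M^T)) => j k.
  apply: (@polyfun_linear _ (fun M : 'M[int]_n => (M + M^T) j k)) => t u w.
  by rewrite !mxE; ring.
have fcM : f (0 + \sum_(p <- L) p.1 *: p.2) != 0.
  rewrite add0r -cM /f linearZ /= symM0 -scalerDl pivots_scale.
  rewrite mulf_neq0 // expf_neq0 //.
  by rewrite -mulr2n mulrn_eq0.
have [L' [mapL' smallL']] := polyfun_small pf fcM; rewrite add0r => nz.
have L'P p : p \in L' -> exists2 q, q \in L & p.2 = q.2.
  move=> /(map_f snd); rewrite mapL' => /mapP[q Lq pq]; by exists q.
set M := \sum_(p <- L') _ in nz.
have M0' x : x \in S -> qval M x = 0.
  move=> Sx; rewrite qval_sum big_seq big1 // => p /L'P[q /LP[qS _] ->].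
  by rewrite qS // mulr0.
have leM i j : (`|M i j| <= n * n * (7 * ((2 * (n * n)) ^ e * B ^ (2 * e))))%N.
  set h := ((2 * (n * n)) ^ e * B ^ (2 * e))%N.
  have le_h p : p \in L' -> (`|(p.1 *: p.2) i j| <= 7 * h)%N.
    move=> L'p; rewrite mxE abszM leq_mul ?smallL' //.
    have [q /LP[_ qB] ->] := L'P _ L'p.
    apply: leq_trans (qB i j) _.
    apply: (@leq_trans ((2 * (n * n * (B * B))) ^ e)%N).
      rewrite leq_pexp2l ?muln_gt0 ?B_gt0 // leq_subLR (leq_trans _ (leq_addl _ _)) //.
      by rewrite leq_exp2l // leq_subr.
    by rewrite /h mulnA expnMn expnM mulnn.
  rewrite summxE -lez_nat abszE; apply: le_trans (ler_norm_sum _ _ _) _.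
  apply: (@le_trans _ _ (\sum_(p <- L') (7 * h)%N%:Z)).
    rewrite big_seq [leRHS]big_seq; apply: ler_sum => p /le_h.
    by rewrite -abszE lez_nat.
  rewrite big_const_seq count_predT iter_addr addr0 -mulr_natl natz -PoszM.
  rewrite lez_nat leq_mul //.
  by rewrite -(size_map snd) mapL' size_map.
exists (M + M^T); split=> //.
- by rewrite linearD /= trmxK addrC.
- by move=> x Sx; rewrite -[M]scale1r linearZ /= qval_lin qval_tr M0' //.
move=> i j; rewrite !mxE; apply: (@leq_trans (`|M i j| + `|M j i|)%N).
  by move: (M i j) (M j i) => u v; clear; lia.
apply: leq_trans (leq_add (leM i j) (leM j i)) _.
by move: ((_ ^ e)%N) (B ^ _)%N => a b; apply: eq_leq; ring.
Qed.

(** * Small coordinates with nonzero pivots *)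

(** The Schur complement along a vector: by [schur_congr], [schur i] after a change of coordinates U
    is this complement along row i of U. *)
Definition schurv (R : pzRingType) n (u : 'rV[R]_n) (A : 'M[R]_n) : 'M[R]_n :=
  qval A u *: A - (A *m u^T) *m (u *m A).

Lemma col_mulmx (R : comPzRingType) m n p (j : 'I_p)
    (A : 'M[R]_(m, n)) (B : 'M[R]_(n, p)) :
  col j (A *m B) = A *m col j B.
Proof. by apply/matrixP => i k; rewrite !mxE; apply: eq_bigr => l _; rewrite !mxE. Qed.

Lemma qval_diag (R : comPzRingType) n (A U : 'M[R]_n) i :
  (U *m A *m U^T) i i = qval A (row i U).
Proof.
have -> : (U *m A *m U^T) i i = (col i (row i (U *m A *m U^T))) 0 0 by rewrite !mxE.
by rewrite !row_mul !col_mulmx -tr_row.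
Qed.

Lemma schur_congr (R : comPzRingType) n (U A : 'M[R]_n) i :
  schur i (U *m A *m U^T) = U *m schurv (row i U) A *m U^T.
Proof.
have rE : row i (U *m A *m U^T) = row i U *m A *m U^T by rewrite !row_mul.
have cE : col i (U *m A *m U^T) = U *m (A *m (row i U)^T).
  by rewrite -!mulmxA !col_mulmx -tr_row.
rewrite /schur rE cE qval_diag /schurv mulmxBr mulmxBl -scalemxAr -scalemxAl.
by rewrite !mulmxA.
Qed.

Lemma schurv_sym (R : comPzRingType) n (u : 'rV[R]_n) (A : 'M[R]_n) :
  A^T = A -> (schurv u A)^T = schurv u A.
Proof.
by move=> symA; rewrite /schurv linearB linearZ /= !trmx_mul trmxK !symA.
Qed.

Definition rankz n (A : 'M[int]_n) := \rank (map_mx (intr : int -> rat) A).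

(** A nonzero multiple of A differs from the complement by a column times a row. *)
Lemma rankz_schurv n (u : 'rV[int]_n) (A : 'M[int]_n) :
  qval A u != 0 -> (rankz A <= (rankz (schurv u A)).+1)%N.
Proof.
move=> q0; rewrite /rankz.
have qr0 : ((qval A u)%:~R : rat) != 0 by rewrite intr_eq0.
rewrite -(mxrank_scale_nz _ qr0) -map_mxZ.
have -> : qval A u *: A = schurv u A + (A *m u^T) *m (u *m A) by rewrite subrK.
rewrite map_mxD; apply: leq_trans (mxrank_add _ _) _; rewrite -[leqRHS]addn1 leq_add2l.
by rewrite map_mxM; apply: leq_trans (mxrankM_maxl _ _) (rank_leq_col _).
Qed.

(** Either a unit vector works, or the diagonal is zero and the sum of unit vectors i and j has
    value 2 A_ij. *)
Lemma exists_qval_neq0 n (A : 'M[int]_n) : A^T = A -> A != 0 -> exists u, qval A u != 0.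
Proof.
move=> symA A0.
have [/existsP[i Aii]|/existsPn diag0] := boolP [exists i, A i i != 0].
  by exists (row i 1%:M); rewrite -qval_diag mul1mx trmx1 mulmx1.
have : ~~ [forall i, forall j, A i j == 0].
  apply: contra A0 => /forallP A0; apply/eqP/matrixP => i j.
  by rewrite mxE; apply/eqP; move/forallP: (A0 i).
rewrite negb_forall => /existsP[i]; rewrite negb_forall => /existsP[j Aij].
exists (row i 1%:M + row j 1%:M).
have bE k l : (row k 1%:M *m A *m (row l 1%:M)^T) 0 0 = A k l.
  by rewrite tr_row trmx1 -row_mul mul1mx -col_mulmx mulmx1 !mxE.
rewrite /qval linearD /= mulmxDr !mulmxDl mxE [X in X + _]mxE [X in _ + X]mxE !bE.
have := diag0 i; have := diag0 j; rewrite !negbK => /eqP -> /eqP ->.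
have -> : A j i = A i j by rewrite -{1}symA mxE.
by rewrite add0r addr0 -mulr2n mulrn_eq0.
Qed.

(** Each complement lowers the rank by at most one, so rank 3 leaves a nonzero matrix at all three
    stages, and each stage supplies a row of U. *)
Lemma exists_pivots m (A : 'M[int]_m.+3) : A^T = A -> (3 <= rankz A)%N ->
  exists U : 'M[int]_m.+3, pivots (U *m A *m U^T) != 0.
Proof.
move=> symA rkA.
have nz (C : 'M[int]_m.+3) : (0 < rankz C)%N -> C != 0.
  by apply: contraTneq => ->; rewrite /rankz map_mx0 mxrank0.
have [|u qu] := exists_qval_neq0 symA; first by apply: nz; lia.
have := rankz_schurv qu; set A1 := schurv u A => rk1.
have symA1 : A1^T = A1 by apply: schurv_sym.
have [|v qv] := exists_qval_neq0 symA1; first by apply: nz; lia.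
have := rankz_schurv qv; set A2 := schurv v A1 => rk2.
have symA2 : A2^T = A2 by apply: schurv_sym.
have [|w qw] := exists_qval_neq0 symA2; first by apply: nz; lia.
(* The pivots depend on the first three rows only. U may be singular, which [good_coordinates]
   repairs. *)
exists (\matrix_i (if i == ix0 m then u else if i == ix1 m then v else w)).
set U := \matrix_i _.
have r0 : row (ix0 m) U = u by rewrite rowK.
have r1 : row (ix1 m) U = v by rewrite rowK.
have r2 : row (ix2 m) U = w by rewrite rowK.
rewrite /pivots !schur_congr !qval_diag r0 r1 r2.
by rewrite !mulf_neq0.
Qed.

Lemma absz_det n (M : 'M[int]_n) (h : nat) :
  (forall i j, (`|M i j| <= h)%N) -> (`| \det M | <= n`! * h ^ n)%N.
Proof.
move=> leM; rewrite -lez_nat abszE /determinant.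
apply: le_trans (ler_norm_sum _ _ _) _.
apply: (@le_trans _ _ (\sum_(s : 'S_n) (h ^ n)%N%:Z)); last first.
  by rewrite sumr_const -mulr_natl natz -PoszM card_Sn.
apply: ler_sum => s _; rewrite normrM normrX normrN1 expr1n mul1r normr_prod.
have -> : (h ^ n)%N%:Z = \prod_(i < n) h%:Z.
  by rewrite prodr_const card_ord; elim: (n) => // k IHk; rewrite expnS PoszM IHk exprS.
by apply: ler_prod => i _; rewrite normr_ge0 -abszE lez_nat leM.
Qed.

(** The determinant of U and the pivots of U A U^T are polynomials in the entries of U, each nonzero
    somewhere, hence both nonzero at some U with entries bounded in terms of n. The adjugate is
    bounded because x adj(U) will be the new integral coordinates of x. *)
Lemma good_coordinates m : exists D : nat, forall A : 'M[int]_m.+3,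
    A^T = A -> (3 <= rankz A)%N ->
  exists U : 'M[int]_m.+3, [/\ pivots (U *m A *m U^T) != 0, \det U != 0 &
    forall i j, (`|(\adj U) i j| <= D)%N].
Proof.
set n := m.+3; set d := (n * 1 + 7 * 2)%N.
exists ((n.-1)`! * (n * n * d) ^ n.-1)%N => A symA rkA.
have [U0 piv0] := exists_pivots symA rkA.
have pdet : polyfun (n * 1) (fun U : 'M[int]_n => \det U).
  by apply: polyfun_det => j k; apply: polyfun_entry.
have ppiv : polyfun (7 * 2) (fun U : 'M[int]_n => pivots (U *m A *m U^T)).
  apply: (@polyfun_pivots _ m 2 (fun U : 'M[int]_n => U *m A *m U^T)) => j k.
  exact: polyfun_congr.
have det1 : \det (1%:M : 'M[int]_n) != 0 by rewrite det1.
have [U1 nz1] := polyfun_common pdet ppiv det1 piv0.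
pose L := [seq (U1 i j, delta_mx i j : 'M[int]_n) | i <- enum 'I_n, j <- enum 'I_n].
have U1E : U1 = 0 + \sum_(p <- L) p.1 *: p.2.
  rewrite add0r {1}(matrix_sum_delta U1) big_allpairs_dep big_enum /=.
  by apply: eq_bigr => i _; rewrite big_enum.
rewrite U1E in nz1.
have [L' [mapL' smallL']] := polyfun_small (polyfun_mul pdet ppiv) nz1.
rewrite add0r; set U := \sum_(p <- L') _ => nz.
have leU i j : (`|U i j| <= n * n * d)%N.
  rewrite /U summxE -lez_nat abszE; apply: le_trans (ler_norm_sum _ _ _) _.
  apply: (@le_trans _ _ (\sum_(p <- L') d%:Z)).
    rewrite big_seq [leRHS]big_seq; apply: ler_sum => p L'p.
    rewrite -abszE lez_nat mxE abszM -[d]muln1 leq_mul ?smallL' //.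
    have := map_f snd L'p; rewrite mapL' => /mapP[q /allpairsP[[a b] [_ _ ->]] /= ->].
    by rewrite mxE; case: (_ && _).
  rewrite big_const_seq count_predT iter_addr addr0 -mulr_natl natz -PoszM lez_nat.
  by rewrite leq_mul // -(size_map snd) mapL' size_map size_allpairs size_enum_ord.
exists U; move: nz; rewrite mulf_eq0 negb_or => /andP[nzd nzp]; split=> // i j.
rewrite mxE /cofactor abszM abszX exp1n mul1n.
apply: absz_det => k l; rewrite !mxE; exact: leU.
Qed.

Lemma count_forms m k : (0 < k)%N ->
  exists C : nat, forall (A : 'M[int]_m.+3) (B : nat) (s : seq 'rV[int]_m.+3),
    A^T = A -> (3 <= rankz A)%N -> (0 < B)%N -> uniq s ->
    (forall x, x \in s -> qval A x = 0 /\ forall j, (`|x ord0 j| <= B)%N) ->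
  (size s ^ k <= C * B ^ (m.+1 * k + 1))%N.
Proof.
move=> k_gt0.
have [D DP] := good_coordinates m.
have [C1 [E smallP]] := small_form m.
(* With H of order B^E, the factor (H^4 B^2)^6 of [count_zeros] has order B^e. Using [count_zeros]
   with exponent k e and taking an e-th root reduces it to B. *)
set e := (24 * E + 12)%N.
have e_gt0 : (0 < e)%N by rewrite /e addnS.
have ke_gt0 : (0 < k * e)%N by rewrite muln_gt0 k_gt0.
have [C2 countP] := count_zeros m ke_gt0.
set n := m.+3; pose D' := (n * D).+1.
exists (C2 * D' ^ (m.+1 * (k * e)) * (C1 ^ 4 * D' ^ (4 * E + 2)) ^ 6)%N.
move=> A B s symA rkA B_gt0 s_uniq sP.
have [U [nzp nzd leU]] := DP A symA rkA.
pose f (x : 'rV[int]_n) := x *m \adj U.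
have fK x : f x *m U = \det U *: x by rewrite /f -mulmxA mul_adj_mx mul_mx_scalar.
have f_inj : injective f.
  move=> x y /(congr1 (fun z => z *m U)); rewrite !fK => e_xy.
  by apply/rowP => j; move/rowP/(_ j): e_xy; rewrite !mxE => /(mulfI nzd).
have leB' x : x \in s -> forall j, (`|f x ord0 j| <= D' * B)%N.
  move=> /sP[_ leB] j; rewrite mxE -lez_nat abszE.
  apply: le_trans (ler_norm_sum _ _ _) _.
  apply: (@le_trans _ _ (\sum_(j < n) (B * D)%N%:Z)); last first.
    rewrite sumr_const card_ord -mulr_natl natz -PoszM lez_nat.
    by rewrite [(B * D)%N]mulnC mulnA leq_mul2r leqnSn orbT.
  by apply: ler_sum => l _; rewrite -abszE abszM lez_nat leq_mul ?leB ?leU.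
have qf x : x \in s -> qval (U *m A *m U^T) (f x) = 0.
  move=> /sP[Q0 _]; rewrite /qval.
  have -> : f x *m (U *m A *m U^T) *m (f x)^T = (f x *m U) *m A *m (f x *m U)^T.
    by rewrite [(f x *m U)^T]trmx_mul; move: (f x) => y; rewrite !mulmxA.
  rewrite fK linearZ /= -scalemxAr -!scalemxAl mxE [(_ *: _ : 'M_1) 0 0]mxE.
  by rewrite -/(qval A x) Q0 !mulr0.
have [|||x /mapP[y sy ->]|A' [symA' piv' A'0 leA']] :=
    @smallP (D' * B)%N (map f s) (U *m A *m U^T).
- by rewrite muln_gt0.
- by rewrite !trmx_mul trmxK symA mulmxA.
- by [].
- by split; [apply: qf | apply: leB'].
set H := (C1 * (D' * B) ^ E)%N in leA'.
have H_gt0 : (0 < H)%N.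
  apply: leq_trans (leA' (ix0 m) (ix0 m)); rewrite absz_gt0.
  by move: piv'; rewrite /pivots !mulf_eq0 !negb_or -andbA => /and3P[].
have le1 : (size s ^ (k * e) <=
    C2 * (D' * B) ^ (m.+1 * (k * e)) * (H ^ 4 * (D' * B) ^ 2) ^ 6)%N.
  rewrite -(size_map f); apply: countP symA' piv' H_gt0 _ _ leA' _.
  - by rewrite muln_gt0.
  - by rewrite map_inj_uniq.
  move=> y s'y; split; first exact: A'0.
  by move: s'y => /mapP[x sx ->]; apply: leB'.
set C := (C2 * _ * _)%N.
have le2 : ((size s ^ k) ^ e <= (C * B ^ (m.+1 * k + 1)) ^ e)%N.
  rewrite -expnM; apply: leq_trans le1 _.
  apply: (@leq_trans (C * (B ^ (m.+1 * k + 1)) ^ e)%N).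
    rewrite /C /H -(expnM B) mulnDl mul1n -(mulnA m.+1) /e expnD.
    by rewrite !(expnMn D') (mulnC 24) (mulnC 4) !expnD !expnM; apply: eq_leq; ring.
  rewrite expnMn leq_mul2r; apply/orP; right.
  by case: (posnP C) => [->|C_gt0]; rewrite ?exp0n // -{1}[C]expn1 leq_pexp2l.
by move: le2; rewrite leq_exp2r.
Qed.

(** * Integral polynomials *)

(* Twice the Gram matrix, so that all entries are integers. *)
Definition gramz n (F : {mpoly int[n]}) : 'M[int]_n :=
  \matrix_(i, j) ((1 + (i == j)%:R) * F@_(U_(i) + U_(j))).

Lemma gramz_sym n (F : {mpoly int[n]}) : (gramz F)^T = gramz F.
Proof. by apply/matrixP => i j; rewrite !mxE eq_sym addmC. Qed.

Lemma rankz_gramz n (F : {mpoly int[n]}) : rankz (gramz F) = qf_rank F.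
Proof.
rewrite /rankz /qf_rank -[in RHS](@mxrank_scale_nz _ _ _ 2) //; congr (\rank _).
apply/matrixP => i j; rewrite !mxE; case: eqP => [->|_].
  by rewrite intrM; congr (_ * _).
rewrite intrM (_ : (1 + false%:R)%:~R = 1) // mul1r mulrCA divff //.
by rewrite mulr1.
Qed.

(** Both sides count the matchings of (i, j) with (a, b) and with (b, a); for i = j = a = b the two
    coincide, which the factor 1 + [i = j] accounts for. *)
Lemma mnm_pair_count n (a b i j : 'I_n) :
  (1 + (i == j)%:R) * ((U_(a) + U_(b))%MM == (U_(i) + U_(j))%MM)%:R =
  (i == a)%:R * (j == b)%:R + (i == b)%:R * (j == a)%:R :> int.
Proof.
have [e|ne] := eqVneq (U_(a) + U_(b))%MM (U_(i) + U_(j))%MM.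
  have E k : ((a == k) + (b == k) = (i == k) + (j == k))%N.
    by move/mnmP: e => /(_ k); rewrite !mnmDE !mnm1E.
  have := E a; have := E b; have := E i; have := E j.
  rewrite !eqxx (eq_sym a b) (eq_sym a i) (eq_sym a j).
  rewrite (eq_sym b i) (eq_sym b j) (eq_sym j i).
  by move: (b == a) (i == a) (i == b) (j == a) (j == b) (i == j); do 6!case.
rewrite mulr0.
have [ia|_] := eqVneq i a; have [jb|_] := eqVneq j b;
  have [ib|_] := eqVneq i b; have [ja|_] := eqVneq j a; rewrite ?mul0r ?mulr0 ?addr0 //.
all: case/eqP: ne; subst; by rewrite // addmC.
Qed.

Lemma dhomog2_supp n (F : {mpoly int[n]}) m :
  F \is 2.-homog -> m \in msupp F -> exists a b : 'I_n, m = (U_(a) + U_(b))%MM.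
Proof.
move=> /dhomogP homF /homF /= dm.
have [a ma] : exists a, m a != 0%N.
  apply/existsP; apply: contra_eqT dm => /existsPn m0.
  by rewrite mdegE big1 // => i _; apply/eqP; have := m0 i; rewrite negbK.
have le_am : (U_(a) <= m)%MM.
  by apply/mnm_lepP => i; rewrite mnm1E; case: eqP => // <-; rewrite lt0n.
have : mdeg (m - U_(a))%MM == 1%N.
  by rewrite -(eqn_add2r 1) -{1}(mdeg1 a) -mdegD submK // dm.
rewrite mdeg_eq1 => /existsP[b /eqP mb].
by exists b, a; rewrite -mb submK.
Qed.

Lemma qval_gramz n (F : {mpoly int[n]}) (x : 'rV[int]_n) : F \is 2.-homog ->
  qval (gramz F) x = 2 * F.@[fun i => x ord0 i].
Proof.
move=> homF; rewrite qvalE mevalE mulr_sumr.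
have coefE m' : F@_m' = \sum_(m <- msupp F) F@_m * (m == m')%:R.
  rewrite {1}(mpolyE F) raddf_sum /=; apply: eq_bigr => m _.
  by rewrite mcoeffZ mcoeffX.
transitivity (\sum_i \sum_j \sum_(m <- msupp F)
   F@_m * ((1 + (i == j)%:R) * (m == (U_(i) + U_(j))%MM)%:R * (x 0 i * x 0 j))).
  apply: eq_bigr => i _; apply: eq_bigr => j _; rewrite mxE {1}coefE.
  rewrite mulr_sumr mulr_sumr mulr_suml; apply: eq_bigr => m _; ring.
under eq_bigr do rewrite exchange_big /=.
rewrite exchange_big /= big_seq [RHS]big_seq; apply: eq_bigr => m mF.
have [a [b mE]] := dhomog2_supp homF mF.
under eq_bigr do rewrite -mulr_sumr.
rewrite -mulr_sumr [RHS]mulrCA; congr (_ * _); rewrite mE.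
have -> : \prod_(i < n) x ord0 i ^+ (U_(a) + U_(b))%MM i = x 0 a * x 0 b.
  rewrite (eq_bigr (fun i => x 0 i ^+ (a == i) * x 0 i ^+ (b == i))); last first.
    by move=> i _; rewrite mnmDE !mnm1E exprD.
  rewrite big_split /=; congr (_ * _).
    rewrite (bigD1 a) //= eqxx expr1 big1 ?mulr1 // => i.
    by rewrite eq_sym => /negPf ->.
  rewrite (bigD1 b) //= eqxx expr1 big1 ?mulr1 // => i.
  by rewrite eq_sym => /negPf ->.
have single c d : \sum_(i < n) \sum_(j < n)
    (i == c)%:R * (j == d)%:R * (x 0 i * x 0 j) = x 0 c * x 0 d.
  rewrite (bigD1 c) //= [X in _ + X]big1 ?addr0 => [|i /negPf ->]; last first.
    by rewrite big1 // => j _; rewrite !mul0r.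
  rewrite (bigD1 d) //= [X in _ + X]big1 ?addr0 => [|j /negPf ->]; last first.
    by rewrite mulr0 mul0r.
  by rewrite !eqxx !mul1r.
under eq_bigr => i _ do under eq_bigr => j _ do rewrite mnm_pair_count mulrDl.
under eq_bigr do rewrite big_split /=.
by rewrite big_split /= !single; ring.
Qed.

Theorem theorem2 (R : realType) (n : nat) (hn : (3 <= n)%N)
    (eps : R) (heps : 0 < eps) :
  exists c : R, forall F : {mpoly int[n]},
    F \is 2.-homog -> (3 <= qf_rank F)%N ->
    forall B : R, 1 <= B ->
      (Ncount F B)%:R <= c * B `^ (n%:R - 2 + eps).
Proof.
case: n hn => [|[|[|m]]] // _.
(* Since k > 1 / eps, the surplus exponent 1 / k left by [count_forms] is below eps. *)
pose k := (Num.truncn eps^-1).+1.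
have k_eps : 1 <= k%:R * eps.
  by rewrite -ler_pdivrMr // div1r ltW // truncnS_gt.
have [C countC] := count_forms m (ltn0Sn k.-1).
exists C%:R => F homF rkF B B1.
have B0 : 0 < B by apply: lt_le_trans B1.
set b := Num.truncn B.
have b_le : b%:R <= B by rewrite truncn_le ltW.
have b_gt0 : (0 < b)%N by rewrite truncn_gt0.
set S := fset_set (zeros_upto F B).
have S_P x : x \in (S : seq _) ->
    qval (gramz F) x = 0 /\ forall j, (`|x ord0 j| <= b)%N.
  rewrite in_fset_set; last exact: finite_zeros_upto.
  rewrite inE => -[_ Fx hx]; split; first by rewrite qval_gramz // Fx mulr0.
  move=> j; rewrite truncn_ge_nat ?(ltW B0) //; apply: le_trans hx.
  by rewrite ler_nat /height (leq_bigmax j).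
have := countC _ b (S : seq _) (gramz_sym F) _ b_gt0 (fset_uniq _) S_P.
rewrite rankz_gramz => /(_ rkF); rewrite -[size _]/(Ncount F B) => le_count.
have k_gt0 : (0 < k)%N by [].
(* After raising to the k-th power, the exponents to compare are (n - 2) k + 1 and (n - 2 + eps)
   k. *)
rewrite -(@ler_pXn2r _ k) ?nnegrE ?mulr_ge0 ?powR_ge0 //.
rewrite exprMn -[_ `^ _ ^+ k]powR_mulrn ?powR_ge0 // -powRrM.
apply: (@le_trans _ _ (C%:R * B `^ ((m.+1 * k + 1)%N%:R))).
  rewrite powR_mulrn ?(ltW B0) //; apply: (@le_trans _ _ (C * b ^ (m.+1 * k + 1))%N%:R).
    by rewrite -natrX ler_nat.
  rewrite natrM natrX ler_wpM2l // ler_pXn2r ?nnegrE ?(ltW B0) // addn1 //.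
apply: ler_pM; rewrite ?powR_ge0 //.
  rewrite -natrX ler_nat; case: (posnP C) => [->|C_gt0]; first by rewrite exp0n.
  by rewrite -{1}[C]expn1 leq_pexp2l.
apply: ler_powR => //.
rewrite natrD natrM mulrDl [eps * _]mulrC lerD // ler_pM2r ?ltr0n //.
by rewrite lerBrDr -natrD ler_nat addn2.
Qed.
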